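(* Let $G=C_{n_1}\cup C_{n_2}\cup\ldots\cup C_{n_k}$ be a vertex-disjoint union of $k\ge 1$ cycles (each $n_i\ge 3$). (i) If $G$ is one of $C_3$, $C_4$, $C_5$, $C_6$, $2C_3$, then there is no packing of three copies of $G$. (ii) If $G$ is one of $C_7$, $C_8$, $C_3\cup C_4$, $C_4\cup C_4$, $C_3\cup C_5$, $3C_3$, then $G$ has a unique packing of three copies. (iii) For any other such graph $G$, there exist at least two distinct packings of three copies of $G$.
   Context: All graphs are finite, undirected, without loops or multiple edges. $C_m$ ($m\ge 3$) denotes the cycle on $m$ vertices; $H_1\cup H_2$ denotes the union of vertex-disjoint graphs, and $mH$ the union of $m$ vertex-disjoint copies of $H$. The members of the lists are understood up to isomorphism. Packing of three copies: let $G_1,G_2,G_3$ be three copies of a graph $G$ of order $n$. A packing of three copies of $G$ (into the complete graph $K_n$) consists of injections $\alpha_i:V(G_i)\to V(K_n)$, $i\in\{1,2,3\}$, such that $\alpha_i^*(E(G_i))\cap\alpha_j^*(E(G_j))=\emptyset$ for $i\ne j$, where $\alpha_i^*:E(G_i)\to E(K_n)$ is the map on edges induced by $\alpha_i$. Write $\alpha_i(G)$ for the graph with vertex set $V(K_n)$ and edge set $\alpha_i^*(E(G_i))$. For graphs $H_1,H_2$ with the same vertex set and disjoint edge sets, $H_1\oplus H_2$ is the graph with that vertex set and edge set $E(H_1)\cup E(H_2)$. Two packings $\alpha,\alpha'$ of three copies of $G$ are distinct if the graphs $\alpha_1(G)\oplus\alpha_2(G)\oplus\alpha_3(G)$ and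 $\alpha_1'(G)\oplus\alpha_2'(G)\oplus\alpha_3'(G)$ are not isomorphic. $G$ has a unique packing of three copies if such a packing exists and no two packings of three copies of $G$ are distinct. *)

(* Defs.v *)
From mathcomp Require Import all_boot.

Set Implicit Arguments.
Unset Strict Implicit.
Unset Printing Implicit Defensive.

(* A simple graph on the vertex set [V]: its edges are 2-element sets. *)
Record sgraph (V : finType) := SGraph {
  edges : {set {set V}};
  card_edge : forall e, e \in edges -> #|e| = 2
}.

Definition iso (V W : finType) (G : sgraph V) (H : sgraph W) : Prop :=
  exists2 f : V -> W, bijective f &
    forall x y : V, ([set f x; f y] \in edges H) = ([set x; y] \in edges G).

(* For [2 < m] the condition [i != ordS i] always holds and this is the cycle
   0, 1, ..., m - 1, 0; the condition only serves to make the definition total,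
   removing the loop for m = 1. *)
Definition cycle_edges (m : nat) : {set {set 'I_m}} :=
  [set [set i; ordS i] | i : 'I_m & i != ordS i].

Fact card_cycle_edges m e : e \in cycle_edges m -> #|e| = 2.
Proof. by case/imsetP=> i; rewrite inE => ni ->; rewrite cards2 ni. Qed.

Definition cycle_graph (m : nat) : sgraph 'I_m := SGraph (@card_cycle_edges m).

Section DisjointUnion.
Variables (I : finType) (V : I -> finType) (G : forall i, sgraph (V i)).

Definition dunion_edges : {set {set {i : I & V i}}} :=
  \bigcup_(i : I) [set [set Tagged V x | x in e] | e : {set V i} in edges (G i)].

Fact card_dunion_edges e : e \in dunion_edges -> #|e| = 2.
Proof.
case/bigcupP=> i _ /imsetP[d Gd ->].
by rewrite card_imset ?(card_edge Gd) // => x y /eqP; rewrite eq_Tagged => /eqP.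
Qed.

Definition dunion : sgraph {i : I & V i} := SGraph card_dunion_edges.
End DisjointUnion.

(* [cycles [:: n1; ...; nk]] is the vertex-disjoint union of the cycles
   on n1, ..., nk vertices. *)
Definition cycles (ns : seq nat) :
    sgraph {i : 'I_(size ns) & 'I_(nth 0 ns i)} :=
  dunion (fun i : 'I_(size ns) => cycle_graph (nth 0 ns i)).

Section Image.
Variables (V W : finType) (f : V -> W) (G : sgraph V).

Definition image_edges : {set {set W}} :=
  [set [set f x | x in e] | e : {set V} in edges G].

Hypothesis inj_f : injective f.

Fact card_image_edges e : e \in image_edges -> #|e| = 2.
Proof. by case/imsetP=> d Gd ->; rewrite card_imset ?(card_edge Gd). Qed.

Definition image_graph : sgraph W := SGraph card_image_edges.
End Image.

Section Oplus.
Variables (V : finType) (H1 H2 : sgraph V).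

Fact card_oplus_edges e : e \in edges H1 :|: edges H2 -> #|e| = 2.
Proof. by case/setUP; apply: card_edge. Qed.

(* Only used for edge-disjoint [H1] and [H2]. *)
Definition oplus : sgraph V := SGraph card_oplus_edges.
End Oplus.

(* The complete graph of order n has vertex set ['I_n], here with [n = #|V|],
   the order of [G]; its edges are all the 2-element subsets of ['I_n]. *)
Record packing3 (V : finType) (G : sgraph V) := Packing3 {
  copy_map : 'I_3 -> V -> 'I_#|V|;
  copy_inj : forall i, injective (copy_map i);
  copy_disjoint : forall i j, i != j ->
    image_edges (copy_map i) G :&: image_edges (copy_map j) G = set0
}.

Section Packings.
Variables (V : finType) (G : sgraph V).

Definition packed_copy (a : packing3 G) (i : 'I_3) : sgraph 'I_#|V| :=
  image_graph G (copy_inj (p := a) (i := i)).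

Definition packing_sum (a : packing3 G) : sgraph 'I_#|V| :=
  oplus (oplus (packed_copy a (inord 0)) (packed_copy a (inord 1)))
        (packed_copy a (inord 2)).

Definition distinct_packings (a b : packing3 G) : Prop :=
  ~ iso (packing_sum a) (packing_sum b).

Definition has_packing : Prop := inhabited (packing3 G).

Definition unique_packing : Prop :=
  has_packing /\ ~ exists a b : packing3 G, distinct_packings a b.

Definition one_of (l : seq (seq nat)) : Prop :=
  exists2 ms, ms \in l & iso G (cycles ms).
End Packings.

Definition no_packing_list : seq (seq nat) :=
  [:: [:: 3]; [:: 4]; [:: 5]; [:: 6]; [:: 3; 3]].

Definition unique_packing_list : seq (seq nat) :=
  [:: [:: 7]; [:: 8]; [:: 3; 4]; [:: 4; 4]; [:: 3; 5]; [:: 3; 3; 3]].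

(* Main.v *)
(* In a packing of order n every vertex of the sum has degree 6, so n >= 7. The
   relation "equal or non-adjacent" has classes of size n - 6; for n = 7, 8, and
   for 3C_3 (where the four relations form the affine plane of order 3), it is an
   equivalence, which determines the sum up to isomorphism.

   For larger n, the basic step lengthens a cycle: take one edge in each of its
   three copies, with six distinct ends, and subdivide all three by one new
   vertex. This never creates a K_5, and it keeps a K_5 that contains none of the
   three edges. Edges as required always exist once the cycle is long enough, and
   a finite search covers the lengths before that. Starting from a few explicit
   packings, and taking disjoint unions, one gets for n >= 10 a packing whose sum
   is K_5-free and one whose sum contains a K_5. The exceptions are treated
   separately: K_4 distinguishes packings of order 9 and of kC_3, and 2C_5 has a
   packing with, and one without, an independent triple. *)

Require Import Defs.
From mathcomp Require Import all_boot zify ring.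

Set Implicit Arguments.
Unset Strict Implicit.
Unset Printing Implicit Defensive.

(** * Packings as lists of cycle triples *)

(** The clique size five comes from the lengthening step. The new vertex and one end of each
    subdivided edge may form a K_4, so absence of K_4 can be lost; K_5 is the smallest clique that
    cannot arise. Cliques also suit disjoint unions, since a clique lies within one part, while an
    independent set can be spread over both. Hence K_4 and independent triples are used only where
    no cycle is lengthened: unions of triangles, order 9 and 2C_5. In order 9 a K_5 is impossible:
    the complement of the sum is 2-regular, and five independent vertices there would send ten edges
    to four vertices of degree two. Packings are kept as lists of numbers so that the explicit ones
    can be checked by evaluation; [realize] turns a list into a packing of the graph. *)

Section Arcs.
Variable T : eqType.
Implicit Types (s : seq T) (x y v : T).

Definition swap (e : T * T) := (e.2, e.1).
Definition arcs s := zip s (rot 1 s).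
Definition symm (A : seq (T * T)) := A ++ map swap A.

Lemma swapK : involutive swap. Proof. by case. Qed.

Lemma mem_symm A x y : ((x, y) \in symm A) = ((x, y) \in A) || ((y, x) \in A).
Proof. by rewrite mem_cat -[(x, y)]/(swap (y, x)) mem_map //; apply: inv_inj swapK. Qed.

Lemma perm_symm_cat A B : perm_eq (symm (A ++ B)) (symm A ++ symm B).
Proof. by apply/permP => a; rewrite !(count_cat, map_cat); lia. Qed.

Lemma perm_symm A B : perm_eq A B -> perm_eq (symm A) (symm B).
Proof. by move=> AB; apply: perm_cat => //; apply: perm_map. Qed.

Lemma arcs_cons x s : arcs (x :: s) = rcons (zip (x :: s) s) (last x s, x).
Proof.
rewrite /arcs rot1_cons; move: {2 5}x => y.
by elim: s x => //= z s IHs x; rewrite IHs.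
Qed.

Lemma perm_arcs_cons x s :
  perm_eq (arcs (x :: s)) ((last x s, x) :: zip (x :: s) s).
Proof. by rewrite arcs_cons perm_rcons. Qed.

(** Putting [v] in front breaks only the closing arc [(last x s, x)]. An edge to be subdivided is
    therefore first rotated to that place. *)
Lemma perm_arcs_insert v x s :
  perm_eq (arcs (v :: x :: s)) [:: (v, x), (last x s, v) & zip (x :: s) s].
Proof. by rewrite arcs_cons /= perm_cons perm_rcons. Qed.

Lemma rot_zip n s (t : seq T) :
  size s = size t -> rot n (zip s t) = zip (rot n s) (rot n t).
Proof.
move=> eq_sz; rewrite /rot zip_cat ?size_drop ?eq_sz //; congr (_ ++ _).
  by elim: n s t {eq_sz} => [|n IHn] [|x s] [|y t] //=; case: drop.
by elim: n s t {eq_sz} => [|n IHn] [|x s] [|y t] //=; rewrite IHn.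
Qed.

Lemma perm_arcs_rot n s : perm_eq (arcs (rot n s)) (arcs s).
Proof. by rewrite /arcs rot_rot -rot_zip ?size_rot // perm_rot. Qed.

Lemma arcs_mem s x y : (x, y) \in arcs s -> x \in s /\ y \in s.
Proof.
rewrite -[y \in s](mem_rot 1) => xy_s.
split; [have := map_f fst xy_s | have := map_f snd xy_s].
  by rewrite -/unzip1 unzip1_zip ?size_rot.
by rewrite -/unzip2 unzip2_zip ?size_rot.
Qed.

End Arcs.

Lemma arcs_map (T U : eqType) (f : T -> U) s :
  arcs (map f s) = [seq (f e.1, f e.2) | e <- arcs s].
Proof.
rewrite /arcs -map_rot; elim: s (rot 1 s) => [|x s IHs] [|y t] //=.
by rewrite IHs.
Qed.

(* The three copies of one cycle of [G], each listed in cyclic order; a packing is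
   a list of these, one for each cycle of [G]. *)
Definition cycle3 := (seq nat * seq nat * seq nat)%type.
Implicit Types (t : cycle3) (p : seq cycle3) (V K : seq nat).

Definition arcs3 t := arcs t.1.1 ++ arcs t.1.2 ++ arcs t.2.
Definition links p := flatten [seq symm (arcs3 t) | t <- p].
(** The third list stands for all three, which have one length in a [balanced] triple. *)
Definition lens p := [seq size t.2 | t <- p].
Definition copy1 p := flatten [seq t.1.1 | t <- p].
Definition copy2 p := flatten [seq t.1.2 | t <- p].
Definition copy3 p := flatten [seq t.2 | t <- p].
Definition balanced t := [&& 2 < size t.2, size t.1.1 == size t.2 & size t.1.2 == size t.2].

(* Edges are recorded in both directions, so that [uniq (links p)] says that the
   three copies are simple and pairwise edge-disjoint. *)
Definition packs V p :=
  [&& [&& perm_eq (copy1 p) V, perm_eq (copy2 p) V & perm_eq (copy3 p) V],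
      uniq V, all balanced p & uniq (links p)].

Lemma links_cons t p : links (t :: p) = symm (arcs3 t) ++ links p.
Proof. by []. Qed.

Lemma links_cat p1 p2 : links (p1 ++ p2) = links p1 ++ links p2.
Proof. by rewrite /links map_cat flatten_cat. Qed.

Lemma packs_perm V p p' : perm_eq p p' -> packs V p = packs V p'.
Proof.
move=> pp'; have fl (S : eqType) (f : cycle3 -> seq S) :
    perm_eq (flatten (map f p)) (flatten (map f p')).
  by apply/perm_flatten/perm_map.
by rewrite /packs (permPl (fl _ _)) (permPl (fl _ _)) (permPl (fl _ _))
  (perm_all _ pp') (perm_uniq (fl _ _)).
Qed.

Lemma links_perm p p' : perm_eq p p' -> links p =i links p'.
Proof. by move=> pp'; apply/perm_mem/perm_flatten/perm_map. Qed.

Lemma links_mem V p x y : packs V p -> (x, y) \in links p -> x \in V /\ y \in V.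
Proof.
case/and4P => /and3P[V1 V2 V3] _ _ _ {}/flattenP[_ /mapP[t pt ->]].
have side (f : cycle3 -> seq nat) u v : perm_eq (flatten (map f p)) V ->
    (u, v) \in arcs (f t) -> u \in V /\ v \in V.
  move=> /perm_mem fV /arcs_mem[u_t v_t].
  by rewrite -!fV; split; apply/flattenP; exists (f t); rewrite ?map_f.
have side1 := side (fun u => u.1.1) _ _ V1; have side2 := side (fun u => u.1.2) _ _ V2.
have side3 := side (fun u => u.2) _ _ V3.
by rewrite mem_symm !mem_cat => /orP[] /or3P[/side1 | /side2 | /side3] [].
Qed.

(* For [b = true] this is a clique of size [q], for [b = false] an independent set. *)
Definition homog V p b q := exists K,
  [/\ uniq K, size K = q, {subset K <= V} &
      {in K &, forall x y, x != y -> ((x, y) \in links p) = b}].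

(** Unlike [homog], this names the clique, which has to be followed through the lengthening. *)
Definition complete p K := {in K &, forall x y, x != y -> (x, y) \in links p}.

Definition map3 (f : nat -> nat) t : cycle3 := (map f t.1.1, map f t.1.2, map f t.2).
Definition rot3 i j k t : cycle3 := (rot i t.1.1, rot j t.1.2, rot k t.2).
Definition insert3 v t : cycle3 := (v :: t.1.1, v :: t.1.2, v :: t.2).

Definition ends (s : seq nat) := [:: head 0 s; last 0 s].
(* The edges to be subdivided join the last and first vertices of the three lists;
   none of them may lie inside [K]. *)
Definition splittable K t :=
  let E := [:: ends t.1.1; ends t.1.2; ends t.2] in
  uniq (flatten E) && all (fun e => ~~ all (mem K) e) E.

Lemma rot3_packs i j k t V p : packs V (rot3 i j k t :: p) = packs V (t :: p).
Proof.
have rotV n (s s' : seq nat) : perm_eq (rot n s ++ s') V = perm_eq (s ++ s') V.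
  by have /permPl-> : perm_eq (rot n s ++ s') (s ++ s') by rewrite perm_cat ?perm_rot.
rewrite /packs /copy1 /copy2 /copy3 /= !rotV /balanced /= !size_rot.
congr [&& _, _, _ & _]; apply/perm_uniq; rewrite !links_cons perm_cat2r.
by apply/perm_symm; do 2?apply: perm_cat => //; apply: perm_arcs_rot.
Qed.

(** * Lengthening a cycle *)

(* Otherwise [count_cat] and [mem_cat] look for concatenations inside [rot]. *)
Opaque arcs.

Section Insertion.
Variables (V : seq nat) (p : seq cycle3) (v : nat).
Variables (x1 x2 x3 : nat) (s1 s2 s3 : seq nat).
Let t : cycle3 := (x1 :: s1, x2 :: s2, x3 :: s3).
Let l1 := last x1 s1. 
Let l2 := last x2 s2.
Let l3 := last x3 s3.
Let cut := [:: (l1, x1); (l2, x2); (l3, x3)].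
Let E := [:: x1; l1; x2; l2; x3; l3].
Let rest := symm (zip (x1 :: s1) s1 ++ zip (x2 :: s2) s2 ++ zip (x3 :: s3) s3) ++ links p.

(** This and the next lemma express the links before and after insertion through the same [rest]:
    only the three cut edges give way to the six edges at [v]. *)
Lemma links_before_insert : perm_eq (links (t :: p)) (symm cut ++ rest).
Proof.
rewrite links_cons catA perm_cat2r.
apply: (perm_trans (perm_symm _) (perm_symm_cat _ _)).
apply/permP => a; rewrite /arcs3 /insert3 /t /= !count_cat.
rewrite !(permP (perm_arcs_cons _ _)) /= -/l1 -/l2 -/l3; lia.
Qed.

Lemma links_after_insert :
  perm_eq (links (insert3 v t :: p))
    ([seq (v, y) | y <- E] ++ [seq (y, v) | y <- E] ++ rest).
Proof.
pose A := [:: (v, x1); (l1, v); (v, x2); (l2, v); (v, x3); (l3, v)].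
pose Z := zip (x1 :: s1) s1 ++ zip (x2 :: s2) s2 ++ zip (x3 :: s3) s3.
rewrite links_cons /rest -/Z; set B := map _ _; set C := map _ _.
rewrite [B ++ _]catA [(B ++ C) ++ _]catA perm_cat2r.
have AZ : perm_eq (arcs3 (insert3 v t)) (A ++ Z).
  apply/permP => a; rewrite /arcs3 /insert3 /t /= !count_cat.
  rewrite !(permP (perm_arcs_insert _ _ _)) /= -/l1 -/l2 -/l3; lia.
apply: perm_trans (perm_symm AZ) (perm_trans (perm_symm_cat _ _) _).
rewrite perm_cat2r; apply/permP => a; rewrite /= /symm /B /C /= /swap /=.
ring.
Qed.

Hypotheses (Vtp : packs V (t :: p)) (vV : v \notin V) (uE : uniq E).

Let linkV x y : (x, y) \in links (t :: p) -> x \in V /\ y \in V := links_mem Vtp.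

Let memE y : y \in E -> y \in V.
Proof.
have cutV l x : (l, x) \in cut -> l \in V /\ x \in V.
  by move=> lx; apply: linkV; rewrite (perm_mem links_before_insert) mem_cat mem_symm lx.
have [] := cutV l1 x1; first by rewrite inE eqxx.
have [] := cutV l2 x2; first by rewrite !inE eqxx orbT.
have [] := cutV l3 x3; first by rewrite !inE eqxx !orbT.
move=> l3V x3V l2V x2V l1V x1V; rewrite !inE.
by do 5?case/orP => [/eqP-> // |]; move/eqP->.
Qed.

Let vE : v \notin E. Proof. by apply: contra vV => /memE. Qed.

Let uniq_before : uniq (symm cut ++ rest).
Proof. by rewrite -(perm_uniq links_before_insert); case/and4P: Vtp. Qed.

Let restV x y : (x, y) \in rest -> x \in V /\ y \in V.
Proof.
by move=> xy; apply: linkV; rewrite (perm_mem links_before_insert) mem_cat xy orbT.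
Qed.

Lemma mem_after_insert x y : ((x, y) \in links (insert3 v t :: p)) =
  [|| (x == v) && (y \in E), (y == v) && (x \in E) | (x, y) \in rest].
Proof.
rewrite (perm_mem links_after_insert) !mem_cat; congr [|| _, _ | _].
  apply/mapP/andP => [[z zE [-> ->]] | [/eqP-> yE]]; first by rewrite eqxx.
  by exists y.
apply/mapP/andP => [[z zE [-> ->]] | [/eqP-> xE]]; first by rewrite eqxx.
by exists x.
Qed.

(** The new links contain [v], so none of them is in [rest]; they differ from each other because the
    six ends do. *)
Lemma packs_insert : packs (v :: V) (insert3 v t :: p).
Proof.
case/and4P: Vtp => /and3P[V1 V2 V3] uV /andP[bt bp] _; apply/and4P; split.
- by rewrite !perm_cons; apply/and3P.
- by rewrite /= vV.
- apply/andP; split=> //; move: bt; rewrite /balanced /= !eqSS.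
  by case/and3P => /leqW-> -> ->.
have uR : uniq rest by move: uniq_before; rewrite cat_uniq => /and3P[].
have vR y : ((v, y) \in rest = false) * ((y, v) \in rest = false).
  by split; apply/negP => /restV[yV vV']; case/negP: vV.
rewrite (perm_uniq links_after_insert) cat_uniq [uniq (_ ++ rest)]cat_uniq uR.
rewrite !map_inj_uniq ?uE; [|by move=> ? ? []..].
rewrite andbT andTb; apply/andP; split; apply/hasPn => -[x y].
  rewrite mem_cat => xyCR; apply/negP => /mapP[z zE [xv yz]]; subst.
  move: xyCR; rewrite !vR orbF => /mapP[u _ [_ zv]].
  by move: vE; rewrite -zv zE.
by move=> xyR; apply/negP => /mapP[z zE [xz yv]]; subst; rewrite vR in xyR.
Qed.

Lemma complete_insert K : {subset K <= V} ->
    ~~ has (fun e => (e.1 \in K) && (e.2 \in K)) cut ->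
  complete (t :: p) K -> complete (insert3 v t :: p) K.
Proof.
move=> KV /hasPn cutK Kc x y xK yK /(Kc _ _ xK yK).
rewrite (perm_mem links_before_insert) mem_cat mem_after_insert => /orP[|->].
  by rewrite mem_symm => /orP[/cutK|/cutK] /=; rewrite xK yK.
by rewrite !orbT.
Qed.

(** Links are not repeated, so a cut edge has no second occurrence in [rest], and the new links all
    contain [v]. *)
Lemma cut_after_insert x y :
  (x, y) \in symm cut -> (x, y) \notin links (insert3 v t :: p).
Proof.
move=> xy_cut; have := uniq_before; rewrite cat_uniq => /and3P[_ /hasPn disj _].
have [xV yV] : x \in V /\ y \in V.
  by apply: linkV; rewrite (perm_mem links_before_insert) mem_cat xy_cut.
rewrite mem_after_insert (negbTE (memPn vV x xV)) (negbTE (memPn vV y yV)) /=.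
by apply/negP => /disj /=; rewrite xy_cut.
Qed.

(* A vertex has at most three pairwise adjacent neighbours among the six
   neighbours of [v], since the three subdivided edges have disappeared. *)
Lemma homog_insert : homog (v :: V) (insert3 v t :: p) true 5 -> homog V (t :: p) true 5.
Proof.
case=> K [uK szK KV Kc].
have [vK | vK] := boolP (v \in K); last first.
  exists K; split=> // [x xK | x y xK yK xy].
    by have := KV x xK; rewrite inE => /orP[/eqP xv|//]; rewrite -xv xK in vK.
  have := Kc _ _ xK yK xy; rewrite mem_after_insert.
  rewrite !(negbTE (memPn vK _ _)) //= => xyR.
  by rewrite (perm_mem links_before_insert) mem_cat xyR orbT.
pose K' := rem v K; have uK' : uniq K' := rem_uniq v uK.
have K'K y : y \in K' -> (y \in K) && (y != v) by rewrite mem_rem_uniq // inE andbC.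
have K'E y : y \in K' -> y \in E.
  move=> /K'K/andP[yK yv]; have := Kc v y vK yK; rewrite eq_sym => /(_ yv).
  rewrite mem_after_insert eqxx (negbTE yv) /= => /orP[//|/restV[]].
  by rewrite (negbTE vV).
(* [c] numbers the cut edge of which a neighbour of [v] is an end. Two members of [K'] with the same
   number would be joined by an edge that is gone, so four vertices would need four numbers out of
   three. *)
pose c y := if y \in [:: x1; l1] then 0 else if y \in [:: x2; l2] then 1 else 2.
have cinj : {in K' &, injective c}.
  move=> y z yK' zK' cyz; apply/eqP/negPn/negP => yz.
  have /andP[yK _] := K'K _ yK'; have /andP[zK _] := K'K _ zK'.
  have := Kc _ _ yK zK yz; apply/negP/cut_after_insert.
  have pair x l : (l, x) \in cut -> y \in [:: x; l] -> z \in [:: x; l] ->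
      (y, z) \in symm cut.
    rewrite mem_symm => lx; set G := _ || _; rewrite !inE /G => /orP[]/eqP yE /orP[]/eqP zE;
      by move: yz; rewrite yE zE ?eqxx ?lx ?orbT.
  have split_E u : u \in E -> [|| u \in [:: x1; l1], u \in [:: x2; l2] | u \in [:: x3; l3]].
    by rewrite /E !inE -!orbA.
  move: cyz (split_E y (K'E _ yK')) (split_E z (K'E _ zK')); rewrite /c.
  case: ifP => [y1 | _].
    case: ifP => [z1 _ _ _ | _]; last by case: ifP.
    by apply: pair y1 z1; rewrite !inE eqxx.
  case: ifP => [y2 | _].
    case: ifP => // _; case: ifP => // z2 _ _ _.
    by apply: pair y2 z2; rewrite !inE eqxx orbT.
  do 2?case: ifP => // _; move=> _ /= y3 z3.
  by apply: pair y3 z3; rewrite !inE eqxx !orbT.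
have : size (map c K') <= size (iota 0 3).
  apply: uniq_leq_size => [|i /mapP[y _ ->]]; first by rewrite map_inj_in_uniq.
  by rewrite mem_iota /c; do 2?case: ifP.
by rewrite size_map size_rem // szK.
Qed.
End Insertion.

(** * Repeated lengthening *)

(** One relation serves both purposes: the fixed clique [K] is carried forwards, while [grows_homog]
    runs backwards, so that absence of a 5-clique is inherited. *)
Record grows K V p V' p' : Prop := Grows {
  grows_packs : packs V' p';
  grows_sub : {subset V <= V'};
  grows_complete : complete p K -> complete p' K;
  grows_homog : homog V' p' true 5 -> homog V p true 5
}.

Lemma grows_refl K V p p' : packs V p -> perm_eq p p' -> grows K V p V p'.
Proof.
move=> Vp pp'; split; rewrite -?(packs_perm _ pp') //.
  by move=> Kp x y xK yK xy; rewrite -(links_perm pp') Kp.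
by case=> L [uL sL LV Lp]; exists L; split=> // x y xL yL xy; rewrite (links_perm pp') Lp.
Qed.

Lemma grows_trans K V p V' p' V'' p'' :
  grows K V p V' p' -> grows K V' p' V'' p'' -> grows K V p V'' p''.
Proof.
case=> _ s1 c1 h1 [k2 s2 c2 h2]; split=> //; first by move=> x /s1/s2.
  by move=> /c1/c2.
by move=> /h2/h1.
Qed.

Lemma grows_rot K V p t i j k : packs V (t :: p) ->
  grows K V (t :: p) V (rot3 i j k t :: p).
Proof.
move=> Vp.
have lnk : links (t :: p) =i links (rot3 i j k t :: p).
  apply/perm_mem; rewrite !links_cons perm_cat2r.
  apply/perm_symm; rewrite /arcs3 perm_sym.
  by do 2?apply: perm_cat => //; apply: perm_arcs_rot.
split; rewrite ?rot3_packs //.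
  by move=> Kp x y xK yK xy; rewrite -lnk Kp.
by case=> L [uL sL LV Lp]; exists L; split=> // x y xL yL xy; rewrite lnk Lp.
Qed.

Lemma grows_insert K V p t v : packs V (t :: p) -> v \notin V ->
  {subset K <= V} -> splittable K t ->
  grows K V (t :: p) (v :: V) (insert3 v t :: p).
Proof.
case: t => [[[|x1 s1] s2] s3]; first by move=> /and4P[_ _ /andP[/and3P[+ /eqP<-]]].
case: s2 s3 => [|x2 s2] [|x3 s3]; try by move=> /and4P[_ _ /andP[/and3P[]]].
move=> Vp vV KV /andP[uE cutK]; split.
- exact: packs_insert.
- by move=> x xV; rewrite inE xV orbT.
- apply: (@complete_insert V p v x1 x2 x3 s1 s2 s3 K) => //; move: cutK.
  by rewrite /= orbF !negb_or !andbT ![(last _ _ \in K) && _]andbC.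
- exact: homog_insert.
Qed.

(** A finite certificate for unlimited lengthening: it records insertions up to the length from
    which [splittable_long] supplies every further one. It mentions only [K] and one triple, so each
    cycle can be certified by itself. *)
Inductive stretchable K : cycle3 -> Prop :=
| StretchLong t : size K + 9 <= size t.2 -> stretchable K t
| StretchInsert t v i j k :
    v \notin K ++ t.1.1 ++ t.1.2 ++ t.2 -> splittable K (rot3 i j k t) ->
    stretchable K (insert3 v (rot3 i j k t)) -> stretchable K t.

Lemma splittable_map f K t : injective f ->
  splittable K t -> splittable (map f K) (map3 f t).
Proof.
move=> f_inj; case: t => [[[|x1 s1] [|x2 s2]] [|x3 s3]] //; rewrite /splittable.
all: try by case/andP; rewrite /= ?inE ?eqxx ?orbT ?andbF.
case/andP => uE cutK; apply/andP; split.
  by rewrite /= !last_map; move: uE; rewrite -(map_inj_uniq f_inj).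
by rewrite /= !last_map !mem_map.
Qed.

Lemma map3_rot f i j k t : map3 f (rot3 i j k t) = rot3 i j k (map3 f t).
Proof. by rewrite /map3 /rot3 /= !map_rot. Qed.

Lemma stretchable_map f K t : injective f ->
  stretchable K t -> stretchable (map f K) (map3 f t).
Proof.
move=> f_inj; elim=> {}t => [long | v i j k vt splt _ IH].
  by apply: StretchLong; rewrite /= !size_map.
apply: (@StretchInsert _ _ (f v) i j k); rewrite -?map3_rot //.
- by rewrite -!map_cat mem_map.
- exact: splittable_map.
Qed.

Lemma mem_leq_sumn (s : seq nat) x : x \in s -> x <= sumn s.
Proof.
elim: s => //= y s IHs; rewrite inE => /orP[/eqP-> | /IHs]; first exact: leq_addr.
by move/leq_trans; apply; apply: leq_addl.
Qed.

Lemma fresh (s : seq nat) : exists v, v \notin s.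
Proof. by exists (sumn s).+1; apply/negP => /mem_leq_sumn; rewrite ltnn. Qed.

(* Exchange the two labels. *)
Lemma stretchable_relabel K t v w : v \notin K ++ t.1.1 ++ t.1.2 ++ t.2 ->
  w \notin K ++ t.1.1 ++ t.1.2 ++ t.2 ->
  stretchable K (insert3 v t) -> stretchable K (insert3 w t).
Proof.
move=> vt wt.
pose f x := if x == v then w else if x == w then v else x.
have f_inj : injective f.
  apply: (can_inj (g := f)) => x; rewrite /f.
  have [-> | xv] := eqVneq x v; first by rewrite eqxx; case: eqP.
  by have [-> | xw] := eqVneq x w; rewrite ?eqxx ?(negbTE xv) ?(negbTE xw).
have fK (s : seq nat) : {subset s <= K ++ t.1.1 ++ t.1.2 ++ t.2} -> map f s = s.
  move=> sub; rewrite -[RHS]map_id; apply/eq_in_map => x /sub xt; rewrite /f.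
  by rewrite (negbTE (memPn vt x xt)) (negbTE (memPn wt x xt)).
move/(stretchable_map f_inj); rewrite /map3 /= (_ : f v = w) ?/f ?eqxx // -/f !fK //.
all: by move=> x xs; rewrite !mem_cat xs ?orbT.
Qed.

(* Each vertex of the cycle is an end of only two of its edges, so [size K + 2 * 4]
   edges at most are excluded by [K] and by the edges already chosen. *)
Lemma splittable_long K V p t : packs V (t :: p) -> size K + 9 <= size t.2 ->
  exists i j k, splittable K (rot3 i j k t).
Proof.
case: t => [[s1 s2] s3] /= Vp long.
have [/and3P[_ /eqP eq1 /eqP eq2] [u1 u2 u3]] :
    balanced (s1, s2, s3) /\ [/\ uniq s1, uniq s2 & uniq s3].
  case/and4P: Vp => /and3P[V1 V2 V3] uV /andP[bt _] _; split=> //.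
  have uniq_hd s s' : perm_eq (s ++ s') V -> uniq s.
    by move/perm_uniq; rewrite uV cat_uniq => /and3P[].
  by split; [apply: uniq_hd V1 | apply: uniq_hd V2 | apply: uniq_hd V3].
(* [B] holds the ends already chosen, at most four from two edges. A head outside [K] keeps the edge
   from lying inside [K]; a head outside [B] and outside the successors of [B] makes both ends new,
   the last vertex being the predecessor of the head. *)
have find (s B : seq nat) : uniq s -> size B <= 4 -> size K + 9 <= size s -> exists i,
    ~~ all (mem K) (ends (rot i s)) /\ uniq (B ++ ends (rot i s)) = uniq B.
  move=> us sB ls; pose bad : seq nat := K ++ B ++ map (next s) B.
  have sz_bad : size bad = size K + (size B + size B) by rewrite !size_cat size_map.
  have /hasP[x xs xbad] : has [predC bad] s.
    rewrite has_predC; apply/negP => /allP s_bad.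
    have : size s <= size bad := uniq_leq_size us (s_bad : {subset s <= bad}).
    by rewrite sz_bad; lia.
  move: xbad; rewrite !inE /= !mem_cat !negb_or => /and3P[xK xB xnB].
  case: (rot_to xs) => i s' si; exists i; rewrite si /= (negbTE xK); split=> //.
  have us' : uniq (x :: s') by rewrite -si rot_uniq.
  have ls' : 0 < size s'.
    by have := congr1 size si; rewrite size_rot /=; lia.
  have nx : next s (last x s') = x.
    rewrite -(next_rot i us) si.
    by have := cycle_next us'; rewrite /cycle rcons_path => /andP[_ /eqP].
  have lB : last x s' \notin B.
    by apply: contra xnB => lB; apply/mapP; exists (last x s').
  rewrite cat_uniq /= inE (negbTE xB) (negbTE lB) andbT.
  case: s' ls' us' {si nx lB} => //= y s' _ /andP[xs' _].
  rewrite (_ : x == _ = false) ?andbT //.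
  by apply: contraNF xs' => /eqP->; rewrite mem_last.
have [i [Ki ui]] := find s1 [::] u1 isT (etrans (congr1 _ eq1) long).
have [j [Kj uj]] := find s2 (ends (rot i s1)) u2 isT (etrans (congr1 _ eq2) long).
have [k [Kk uk]] := find s3 (ends (rot i s1) ++ ends (rot j s2)) u3 isT long.
exists i, j, k; rewrite /splittable /rot3; apply/andP; split; last by apply/and4P.
exact: etrans uk (etrans uj ui).
Qed.

Lemma grow_head K V p t m : packs V (t :: p) -> {subset K <= V} ->
    stretchable K t -> size t.2 <= m ->
  exists V' t', grows K V (t :: p) V' (t' :: p) /\ size t'.2 = m.
Proof.
move=> Vp KV Kt tm; have [n eq_n] : exists n, n + size t.2 = m.
  by exists (m - size t.2); rewrite subnK.
elim: n V t Vp KV Kt eq_n {tm} => [|n IHn] V t Vp KV Kt eq_n.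
  by exists V, t; split=> //; apply: grows_refl.
(* Both kinds of certificate yield the same step: rotate, then insert an arbitrary vertex outside
   [V]. *)
suff [i [j [k [splt Kt']]]] : exists i j k, splittable K (rot3 i j k t) /\
    forall v, v \notin V -> stretchable K (insert3 v (rot3 i j k t)).
  have [v vV] := fresh V; have Vp' := grows_rot K i j k Vp.
  have ext := grows_insert (grows_packs Vp') vV KV splt.
  have KvV : {subset K <= v :: V} by move=> x /KV xV; rewrite inE xV orbT.
  have [|V' [t' [ext' <-]]] := IHn _ _ (grows_packs ext) KvV (Kt' v vV).
    by rewrite /= size_rot addnS -addSn.
  by exists V', t'; split=> //; apply: grows_trans Vp' (grows_trans ext ext').
case: Kt Vp {eq_n IHn} => {}t => [long | v i j k vt splt Kt'] Vp.
  have [i [j [k splt]]] := splittable_long Vp long.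
  exists i, j, k; split=> // v _; apply: StretchLong.
  by rewrite /= size_rot ltnW.
have rotE : K ++ (rot3 i j k t).1.1 ++ (rot3 i j k t).1.2 ++ (rot3 i j k t).2
    =i K ++ t.1.1 ++ t.1.2 ++ t.2.
  apply/perm_mem; rewrite perm_cat2l /=.
  by do 2?apply: perm_cat; rewrite perm_rot.
(* The label [v] of the certificate may occur in another cycle, hence the change to [w]. *)
exists i, j, k; split=> // w wV; apply: stretchable_relabel Kt'; first by rewrite rotE.
rewrite rotE.
case/and4P: Vp => /and3P[V1 V2 V3] _ _ _; apply: contra wV.
rewrite !mem_cat => /or4P[/KV // | wt | wt | wt].
- by rewrite -(perm_mem V1) mem_cat wt.
- by rewrite -(perm_mem V2) mem_cat wt.
- by rewrite -(perm_mem V3) mem_cat wt.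
Qed.

(** The alternative of an unchanged length is for a cycle with a copy inside the clique: that copy
    has no edge that may be subdivided. *)
Fixpoint fits K p ms : Prop :=
  match p, ms with
  | t :: p', m :: ms' =>
      (size t.2 = m \/ stretchable K t /\ size t.2 <= m) /\ fits K p' ms'
  | [::], [::] => True
  | _, _ => False
  end.

Lemma grow_all K V p ms : packs V p -> {subset K <= V} -> fits K p ms ->
  exists V' p', grows K V p V' p' /\ lens p' = ms.
Proof.
(* [q] collects the cycles already treated, so that the next one is always at the head. *)
suff H q : packs V (p ++ q) -> {subset K <= V} -> fits K p ms ->
    exists V' p', grows K V (p ++ q) V' (p' ++ q) /\ lens p' = ms.
  move=> Vp KV /(H [::]); rewrite cats0 => /(_ Vp KV) [V' [p' []]].
  by rewrite cats0; exists V', p'.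
elim: p V q ms => [|t p IHp] V q [|m ms] //= Vp KV.
  by exists V, [::]; split=> //; apply: grows_refl.
case=> tm pms.
have [V1 [t' [ext <-]]] : exists V' t',
    grows K V (t :: p ++ q) V' (t' :: p ++ q) /\ size t'.2 = m.
  case: tm => [<- | [Kt tm]]; last exact: grow_head.
  by exists V, t; split=> //; apply: grows_refl.
have mid r : perm_eq (r ++ t' :: q) (t' :: r ++ q) := permEl (perm_catCA r [:: t'] q).
have pq : perm_eq (t' :: p ++ q) (p ++ t' :: q) by rewrite perm_sym mid.
have ext' := grows_trans ext (grows_refl K (grows_packs ext) pq).
have [|V' [p' [ext2 <-]]] := IHp _ _ _ (grows_packs ext') _ pms.
  by move=> x /KV /(grows_sub ext).
exists V', (t' :: p'); split=> //=; apply: grows_trans ext' (grows_trans ext2 _).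
exact: grows_refl (grows_packs ext2) (mid p').
Qed.

(** * Disjoint unions *)

Section Relabel.
Variables (f : nat -> nat) (f_inj : injective f).
Let f2 (e : nat * nat) := (f e.1, f e.2).

Lemma links_map p : links (map (map3 f) p) = map f2 (links p).
Proof.
elim: p => // t p IHp; rewrite [LHS]links_cons links_cons map_cat IHp; congr (_ ++ _).
rewrite /arcs3 /= !arcs_map -!map_cat; set A := _ ++ _.
clearbody A; rewrite /symm map_cat; congr (_ ++ _).
by elim: A => //= e A ->.
Qed.

Lemma mem_links_map p x y : ((f x, f y) \in links (map (map3 f) p)) = ((x, y) \in links p).
Proof.
rewrite links_map -[(f x, f y)]/(f2 (x, y)) mem_map //.
by move=> [a b] [c d] [/f_inj-> /f_inj->].
Qed.

Lemma packs_map V p : packs V p -> packs (map f V) (map (map3 f) p).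
Proof.
case/and4P => /and3P[V1 V2 V3] uV bp ul; apply/and4P; split.
- have mapf (g h : cycle3 -> seq nat) : (forall t, h (map3 f t) = map f (g t)) ->
      perm_eq (flatten (map g p)) V -> perm_eq (flatten (map h (map (map3 f) p))) (map f V).
    move=> hg /(perm_map f); congr perm_eq.
    by elim: (p) => //= t p' IHp; rewrite map_cat IHp hg.
  apply/and3P; split.
  + exact: (mapf (fun t => t.1.1) (fun t => t.1.1)).
  + exact: (mapf (fun t => t.1.2) (fun t => t.1.2)).
  + exact: (mapf (fun t => t.2) (fun t => t.2)).
- by rewrite map_inj_uniq.
- rewrite all_map; apply: sub_all bp => t; by rewrite /balanced /= !size_map.
- by rewrite links_map map_inj_uniq // => -[a b] [c d] [/f_inj-> /f_inj->].
Qed.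

Lemma homog_map V p b q : homog (map f V) (map (map3 f) p) b q <-> homog V p b q.
Proof.
split=> [] [K [uK sK KV Kp]]; last first.
  exists (map f K); rewrite map_inj_uniq // size_map; split=> //.
    by move=> _ /mapP[x /KV xV ->]; apply: map_f.
  move=> _ _ /mapP[x xK ->] /mapP[y yK ->]; rewrite inj_eq // mem_links_map.
  exact: Kp.
have [K' defK] : exists K', K = map f K'.
  elim: K KV {uK sK Kp} => [|x K IHK] KV; first by exists [::].
  have [y yK|K' ->] := IHK; first by apply: KV; rewrite inE yK orbT.
  by have /mapP[y _ ->] := KV x (mem_head _ _); exists (y :: K').
subst K; exists K'; move: uK sK; rewrite map_inj_uniq // size_map => uK sK.
split=> // [x xK | x y xK yK xy].
  by have := KV (f x); rewrite !mem_map // => ->.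
by have := Kp (f x) (f y); rewrite !mem_map // inj_eq // mem_links_map => ->.
Qed.
End Relabel.

Lemma packs_cat V1 V2 p1 p2 : packs V1 p1 -> packs V2 p2 -> ~~ has (mem V1) V2 ->
  packs (V1 ++ V2) (p1 ++ p2).
Proof.
move=> Vp1 Vp2 disj.
have inV1 := links_mem Vp1; have inV2 := links_mem Vp2.
case/and4P: Vp1 => /and3P[A1 A2 A3] u1 b1 l1.
case/and4P: Vp2 => /and3P[B1 B2 B3] u2 b2 l2.
apply/and4P; split.
- rewrite /copy1 /copy2 /copy3 !map_cat !flatten_cat.
  by apply/and3P; split; apply: perm_cat.
- by rewrite cat_uniq u1 u2 disj.
- by rewrite all_cat b1 b2.
rewrite links_cat cat_uniq l1 l2 andbT /=.
apply/hasPn => -[x y] /inV2[xV _]; apply/negP => /inV1[xV' _].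
by case/hasP: disj; exists x.
Qed.

(** No link joins the two sides, so a clique lies entirely on the side of its first vertex. *)
Lemma homog_cat V1 V2 p1 p2 q : packs V1 p1 -> packs V2 p2 -> ~~ has (mem V1) V2 ->
  homog (V1 ++ V2) (p1 ++ p2) true q.+1 <->
  homog V1 p1 true q.+1 \/ homog V2 p2 true q.+1.
Proof.
move=> Vp1 Vp2 /hasPn disj.
have inV1 := links_mem Vp1; have inV2 := links_mem Vp2; split; last first.
  case=> -[K [uK sK KV Kp]]; exists K; split=> //.
  - by move=> x /KV xV; rewrite mem_cat xV.
  - by move=> x y xK yK xy; rewrite links_cat mem_cat Kp.
  - by move=> x /KV xV; rewrite mem_cat xV orbT.
  - by move=> x y xK yK xy; rewrite links_cat mem_cat [X in _ || X]Kp ?orbT.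
case=> -[|x K] [uK sK KV Kp]; first by [].
have xK : x \in x :: K := mem_head x K.
have [xV1 | xV2] : x \in V1 \/ x \in V2 by apply/orP; rewrite -mem_cat KV.
  have KV1 y : y \in x :: K -> y \in V1.
    move=> yK; have [<- // | xy] := eqVneq x y.
    have := Kp x y xK yK xy; rewrite links_cat mem_cat => /orP[/inV1[] // | /inV2[/disj]].
    by rewrite /= xV1.
  left; exists (x :: K); split=> // y z yK zK yz.
  have := Kp y z yK zK yz; rewrite links_cat mem_cat => /orP[// | /inV2[/disj]].
  by rewrite /= KV1.
have KV2 y : y \in x :: K -> y \in V2.
  move=> yK; have [<- // | xy] := eqVneq x y.
  have := Kp x y xK yK xy; rewrite links_cat mem_cat => /orP[/inV1[xV1] | /inV2[] //].
  by have := disj x xV2; rewrite /= xV1.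
right; exists (x :: K); split=> // y z yK zK yz.
have := Kp y z yK zK yz; rewrite links_cat mem_cat => /orP[/inV1[yV1] | //].
by have := disj y (KV2 y yK); rewrite /= yV1.
Qed.

Lemma union_packs V1 p1 V2 p2 q : packs V1 p1 -> packs V2 p2 ->
  exists V p, [/\ packs V p, lens p = lens p1 ++ lens p2 &
    homog V p true q.+1 <-> homog V1 p1 true q.+1 \/ homog V2 p2 true q.+1].
Proof.
(* No label in [V1] exceeds [sumn V1], so this shift separates the two vertex sets. *)
move=> Vp1 Vp2; pose f := addn (sumn V1).+1.
have f_inj : injective f by apply: addnI.
have Vp2' := packs_map f_inj Vp2.
have disj : ~~ has (mem V1) (map f V2).
  apply/hasPn => _ /mapP[x _ ->] /=; apply/negP => /mem_leq_sumn.
  by rewrite /f addSn ltnNge leq_addr.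
exists (V1 ++ map f V2), (p1 ++ map (map3 f) p2); split.
- exact: packs_cat.
- rewrite /lens map_cat -map_comp; congr (_ ++ _).
  by apply: eq_map => t /=; rewrite size_map.
- by rewrite homog_cat // homog_map.
Qed.

(** * Checking concrete packings *)

(** The bit [h] records whether the sum has the homogeneous set; two packings with different bits
    are distinct, and for cliques a disjoint union acts on bits as [||]. *)
Definition realizable ns b q (h : bool) :=
  exists V p, [/\ packs V p, perm_eq (lens p) ns & homog V p b q <-> h].

Lemma realizable_perm ns ms b q h : perm_eq ns ms ->
  realizable ns b q h -> realizable ms b q h.
Proof. by move=> nm [V [p [Vp pn hom]]]; exists V, p; split=> //; apply: perm_trans nm. Qed.

Lemma realizable_cat ns ms q h1 h2 :
  realizable ns true q.+1 h1 -> realizable ms true q.+1 h2 ->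
  realizable (ns ++ ms) true q.+1 (h1 || h2).
Proof.
case=> V1 [p1 [Vp1 pn1 hom1]] [V2 [p2 [Vp2 pn2 hom2]]].
have [V [p [Vp pE homE]]] := union_packs q Vp1 Vp2.
exists V, p; split; rewrite ?pE ?perm_cat //.
rewrite homE hom1 hom2; split; last by move/orP.
by move=> h; apply/orP.
Qed.

(* A lazy [has], so that [stretchb] stops at the first success under call by value. *)
Fixpoint find_true (T : Type) (a : T -> bool) (s : seq T) : bool :=
  if s is x :: s' then if a x then true else find_true a s' else false.

Lemma find_trueP (T : Type) (a : T -> bool) (s : seq T) : find_true a s -> exists x, a x.
Proof. by elim: s => //= x s IHs; case: ifP => [ax _ | _]; [exists x | ]. Qed.

(** A backtracking search with fuel [n], trying all triples of edges. Freshness of the label [v] is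
    tested at each step, so soundness holds for any initial label. *)
Fixpoint stretchb n K v t : bool :=
  if size K + 9 <= size t.2 then true else
  if n is n'.+1 then
    let rots := iota 0 (size t.2) in
    find_true (fun i => find_true (fun j => find_true (fun k =>
      let t' := rot3 i j k t in
      if splittable K t' then
        if v \in K ++ t.1.1 ++ t.1.2 ++ t.2 then false
        else stretchb n' K v.+1 (insert3 v t')
      else false) rots) rots) rots
  else false.

Lemma stretchbP n K v t : stretchb n K v t -> stretchable K t.
Proof.
elim: n v t => [|n IHn] v t /=; case: ifP => [long _ | _ //]; try exact: StretchLong.
case/find_trueP=> i /find_trueP[j /find_trueP[k]]; case: ifP => // splt.
by case: ifP => // /negbT vt /IHn; apply: StretchInsert vt splt.
Qed.

Lemma fits_stretch n K v k p ms :
  all2 leq (lens p) ms -> take k (lens p) == take k ms ->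
  all (stretchb n K v) (drop k p) -> fits K p ms.
Proof.
elim: p ms k => [|t p IHp] [|m ms] [|k] //= /andP[tm pm].
  move=> _ /andP[/stretchbP Kt Kp]; split; first by right.
  by apply: (IHp _ 0) => //; rewrite ?drop0 ?take0.
by rewrite eqseq_cons => /andP[/eqP-> eq_k] Kp; split; [left | apply: IHp eq_k Kp].
Qed.

Definition vertices p := iota 0 (sumn (lens p)).

Definition homogb p b K :=
  [&& uniq K, all (mem (vertices p)) K &
    all (fun x => all (fun y => (x == y) || (((x, y) \in links p) == b)) K) K].

Lemma homogbP p b K : homogb p b K -> homog (vertices p) p b (size K).
Proof.
case/and3P => uK /allP KV /allP Kp; exists K; split=> // x y xK yK xy.
by move/allP: (Kp x xK) => /(_ y yK); rewrite (negbTE xy) => /eqP.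
Qed.

Lemma homogb_complete p K : homogb p true K -> complete p K.
Proof.
case/and3P => _ _ /allP Kp x y xK yK xy.
by move/allP: (Kp x xK) => /(_ y yK); rewrite (negbTE xy) => /eqP.
Qed.

(** [C] holds the vertices compatible with all those chosen so far. The search serves to refute;
    existence is shown by an explicit set. *)
Fixpoint search (L : seq (nat * nat)) b q (C : seq nat) : bool :=
  if q is q'.+1 then
    has (fun x => search L b q' [seq y <- C | (x != y) && (((x, y) \in L) == b)]) C
  else true.

Lemma homog_search V p b q : homog V p b q -> search (links p) b q V.
Proof.
case=> K [+ <- + Kp]; elim: K V Kp => //= x K IHK V Kp /andP[xK uK] KV.
apply/hasP; exists x; first by apply: KV; rewrite mem_head.
apply: IHK => // [y z yK zK yz | y yK].
  by apply: Kp; rewrite // inE ?yK ?zK orbT.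
have xy : x != y by apply: contraNneq xK => ->.
by rewrite mem_filter KV ?Kp ?xy ?eqxx //; rewrite inE ?eqxx ?yK ?orbT.
Qed.

Lemma realizable_free p b q : packs (vertices p) p ->
  ~~ search (links p) b q (vertices p) -> realizable (lens p) b q false.
Proof.
move=> Vp free; exists (vertices p), p; split=> //.
by split=> // /homog_search; rewrite (negbTE free).
Qed.

Lemma realizable_homog p b K : packs (vertices p) p -> homogb p b K ->
  realizable (lens p) b (size K) true.
Proof.
by move=> Vp /homogbP hom; exists (vertices p), p; split.
Qed.

(* Labels of new vertices start at [sumn (lens p)]; eleven insertions bring a
   triangle to length [5 + 9]. *)
Definition stretchy K k p := all (stretchb 12 K (sumn (lens p))) (drop k p).

Lemma realizable_grow_free p ms : packs (vertices p) p ->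
    ~~ search (links p) true 5 (vertices p) -> stretchy [::] 0 p ->
  all2 leq (lens p) ms -> realizable ms true 5 false.
Proof.
move=> Vp free stp pm.
have fit : fits [::] p ms by apply: fits_stretch stp; rewrite ?take0.
have [//|V [q [[Vq _ _ hom] <-]]] := grow_all Vp _ fit.
by exists V, q; split=> //; split=> // /hom /homog_search; rewrite (negbTE free).
Qed.

Lemma realizable_grow_clique k K p ms : packs (vertices p) p ->
    homogb p true K -> size K = 5 -> stretchy K k p ->
  all2 leq (lens p) ms -> take k (lens p) == take k ms -> realizable ms true 5 true.
Proof.
move=> Vp Kp sK stp pm eq_k; have/and3P[uK /allP KV _] := Kp.
have [//|V [q [[Vq sub comp _] <-]]] := grow_all Vp _ (fits_stretch pm eq_k stp).
exists V, q; split=> //; split=> // _; exists K; split=> // [x /KV/sub // |].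
exact/comp/homogb_complete.
Qed.

(* Found by computer search. The vertices 0, 1, 2, ... form a clique of size 5 in
   the sum of [clique_*] (of size 4 for [clique_9], [clique_3_6], [clique_4_5] and
   the unions of at least four triangles); if this clique contains a whole cycle, which
   therefore cannot be lengthened, then this is a copy of the first cycle, or the
   packing is not used for other lengths. *)
Definition free_8 : seq cycle3 :=
  [:: ([:: 0; 1; 6; 2; 4; 5; 7; 3],
       [:: 4; 0; 2; 5; 3; 6; 7; 1],
       [:: 0; 5; 6; 4; 3; 1; 2; 7])].
Definition free_3_5 : seq cycle3 :=
  [:: ([:: 6; 2; 3], [:: 5; 7; 2], [:: 4; 2; 1]);
      ([:: 5; 0; 1; 7; 4], [:: 0; 4; 6; 1; 3], [:: 0; 7; 3; 5; 6])].
Definition free_4_4 : seq cycle3 :=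
  [:: ([:: 7; 6; 1; 2], [:: 4; 6; 2; 3], [:: 3; 7; 4; 1]);
      ([:: 0; 3; 5; 4], [:: 5; 0; 1; 7], [:: 2; 0; 6; 5])].
Definition free_3_3_3 : seq cycle3 :=
  [:: ([:: 2; 6; 5], [:: 1; 7; 5], [:: 7; 2; 8]);
      ([:: 1; 3; 8], [:: 6; 8; 0], [:: 4; 1; 6]);
      ([:: 0; 7; 4], [:: 3; 2; 4], [:: 3; 5; 0])].
Definition free_3_3_3_3 : seq cycle3 :=
  [:: ([:: 2; 4; 1], [:: 9; 2; 5], [:: 10; 7; 2]);
      ([:: 6; 5; 3], [:: 3; 4; 7], [:: 0; 5; 8]);
      ([:: 9; 0; 10], [:: 6; 8; 10], [:: 11; 6; 4]);
      ([:: 11; 7; 8], [:: 1; 0; 11], [:: 9; 1; 3])].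
Definition free_3_3_3_3_3 : seq cycle3 :=
  [:: ([:: 14; 6; 5], [:: 0; 3; 13], [:: 0; 6; 2]);
      ([:: 12; 11; 13], [:: 12; 6; 4], [:: 9; 12; 10]);
      ([:: 2; 4; 8], [:: 2; 14; 10], [:: 11; 1; 14]);
      ([:: 10; 7; 0], [:: 9; 11; 5], [:: 13; 5; 8]);
      ([:: 9; 1; 3], [:: 7; 8; 1], [:: 4; 3; 7])].
Definition free_9 : seq cycle3 :=
  [:: ([:: 2; 8; 3; 6; 7; 4; 5; 0; 1],
       [:: 7; 2; 3; 5; 6; 1; 4; 0; 8],
       [:: 5; 7; 1; 3; 4; 8; 6; 0; 2])].
Definition free_3_6 : seq cycle3 :=
  [:: ([:: 3; 0; 2], [:: 4; 6; 2], [:: 2; 8; 1]);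
      ([:: 8; 6; 7; 4; 1; 5], [:: 1; 7; 8; 0; 5; 3], [:: 7; 3; 6; 5; 4; 0])].
Definition free_4_5 : seq cycle3 :=
  [:: ([:: 6; 1; 5; 7], [:: 4; 1; 8; 7], [:: 7; 2; 1; 3]);
      ([:: 0; 2; 4; 8; 3], [:: 3; 2; 5; 0; 6], [:: 5; 8; 0; 4; 6])].
Definition clique_7 : seq cycle3 :=
  [:: ([:: 3; 5; 0; 6; 4; 1; 2], [:: 4; 3; 0; 2; 6; 1; 5], [:: 0; 1; 3; 6; 5; 2; 4])].
Definition clique_3_4 : seq cycle3 :=
  [:: ([:: 1; 5; 3], [:: 0; 3; 2], [:: 6; 3; 4]);
      ([:: 6; 2; 4; 0], [:: 1; 4; 5; 6], [:: 2; 1; 0; 5])].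
Definition clique_9 : seq cycle3 :=
  [:: ([:: 5; 8; 7; 1; 6; 0; 2; 4; 3],
       [:: 2; 1; 5; 4; 6; 7; 3; 0; 8],
       [:: 3; 1; 0; 5; 7; 4; 8; 6; 2])].
Definition clique_3_6 : seq cycle3 :=
  [:: ([:: 3; 6; 4], [:: 7; 3; 1], [:: 5; 1; 4]);
      ([:: 2; 1; 0; 7; 5; 8], [:: 8; 4; 0; 2; 5; 6], [:: 6; 7; 8; 0; 3; 2])].
Definition clique_4_5 : seq cycle3 :=
  [:: ([:: 0; 5; 7; 8], [:: 1; 5; 6; 0], [:: 4; 5; 8; 1]);
      ([:: 2; 4; 6; 3; 1], [:: 4; 8; 3; 2; 7], [:: 2; 6; 7; 3; 0])].
Definition clique_3_3_3_3 : seq cycle3 :=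
  [:: ([:: 5; 2; 1], [:: 6; 0; 2], [:: 7; 5; 11]);
      ([:: 6; 11; 10], [:: 3; 1; 7], [:: 9; 4; 6]);
      ([:: 8; 4; 7], [:: 4; 5; 10], [:: 1; 0; 8]);
      ([:: 9; 0; 3], [:: 8; 11; 9], [:: 2; 10; 3])].
Definition clique_3_3_3_3_3 : seq cycle3 :=
  [:: ([:: 13; 10; 12], [:: 13; 7; 4], [:: 14; 5; 7]);
      ([:: 3; 1; 7], [:: 2; 11; 1], [:: 9; 13; 6]);
      ([:: 9; 14; 4], [:: 14; 10; 8], [:: 11; 12; 4]);
      ([:: 5; 11; 8], [:: 5; 12; 6], [:: 8; 1; 0]);
      ([:: 2; 0; 6], [:: 0; 9; 3], [:: 2; 10; 3])].
Definition clique_3_3_3_3_3_3 : seq cycle3 :=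
  [:: ([:: 12; 6; 5], [:: 9; 7; 6], [:: 11; 17; 15]);
      ([:: 3; 16; 2], [:: 1; 2; 10], [:: 7; 12; 10]);
      ([:: 17; 0; 1], [:: 11; 8; 13], [:: 3; 1; 6]);
      ([:: 10; 4; 11], [:: 3; 14; 0], [:: 5; 14; 13]);
      ([:: 13; 15; 9], [:: 17; 16; 5], [:: 8; 4; 16]);
      ([:: 14; 7; 8], [:: 12; 15; 4], [:: 2; 9; 0])].
Definition clique_10 : seq cycle3 :=
  [:: ([:: 9; 0; 3; 6; 8; 7; 2; 4; 1; 5],
       [:: 1; 2; 0; 5; 6; 9; 7; 4; 3; 8],
       [:: 5; 7; 6; 2; 3; 1; 0; 4; 9; 8])].
Definition clique_3_7 : seq cycle3 :=
  [:: ([:: 8; 1; 6], [:: 9; 3; 8], [:: 7; 8; 5]);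
      ([:: 9; 5; 4; 3; 0; 2; 7], [:: 5; 6; 7; 0; 4; 1; 2], [:: 1; 3; 2; 4; 6; 9; 0])].
Definition clique_4_6 : seq cycle3 :=
  [:: ([:: 2; 3; 5; 4], [:: 6; 8; 5; 7], [:: 7; 4; 3; 1]);
      ([:: 1; 0; 8; 7; 9; 6], [:: 4; 1; 2; 9; 3; 0], [:: 0; 2; 8; 9; 5; 6])].
Definition clique_5_6 : seq cycle3 :=
  [:: ([:: 10; 3; 4; 6; 7], [:: 7; 5; 6; 10; 9], [:: 9; 2; 3; 1; 6]);
      ([:: 1; 2; 5; 9; 8; 0], [:: 2; 4; 1; 8; 3; 0], [:: 4; 0; 10; 5; 8; 7])].
Definition clique_3_3_4 : seq cycle3 :=
  [:: ([:: 8; 6; 7], [:: 5; 6; 9], [:: 2; 3; 1]);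
      ([:: 5; 2; 4], [:: 2; 0; 8], [:: 6; 0; 4]);
      ([:: 0; 3; 9; 1], [:: 3; 4; 1; 7], [:: 9; 8; 5; 7])].
Definition clique_4_4_4 : seq cycle3 :=
  [:: ([:: 0; 1; 3; 4], [:: 3; 0; 11; 8], [:: 3; 2; 0; 7]);
      ([:: 11; 5; 7; 9], [:: 4; 5; 1; 2], [:: 9; 8; 6; 5]);
      ([:: 2; 6; 10; 8], [:: 10; 9; 6; 7], [:: 10; 1; 4; 11])].
Definition clique_5_5_5 : seq cycle3 :=
  [:: ([:: 2; 1; 3; 4; 0], [:: 12; 14; 0; 5; 9], [:: 0; 3; 2; 4; 1]);
      ([:: 11; 8; 5; 10; 7], [:: 13; 8; 3; 6; 2], [:: 14; 10; 9; 13; 11]);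
      ([:: 6; 12; 13; 14; 9], [:: 11; 1; 7; 4; 10], [:: 7; 8; 6; 5; 12])].
Definition clique_5_5_6 : seq cycle3 :=
  [:: ([:: 10; 3; 1; 2; 8], [:: 8; 4; 2; 3; 0], [:: 10; 15; 14; 7; 9]);
      ([:: 6; 9; 15; 12; 7], [:: 9; 13; 6; 1; 14], [:: 12; 6; 11; 5; 8]);
      ([:: 11; 13; 4; 0; 5; 14], [:: 10; 7; 15; 11; 12; 5], [:: 3; 13; 2; 0; 1; 4])].
Definition clique_3_3_3_4 : seq cycle3 :=
  [:: ([:: 3; 1; 2], [:: 11; 6; 12], [:: 7; 11; 5]);
      ([:: 4; 7; 0], [:: 7; 9; 8], [:: 9; 6; 10]);
      ([:: 5; 8; 6], [:: 1; 10; 4], [:: 0; 1; 12]);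
      ([:: 10; 11; 9; 12], [:: 3; 5; 2; 0], [:: 8; 3; 4; 2])].
Definition clique_4_4_4_4 : seq cycle3 :=
  [:: ([:: 3; 15; 4; 0], [:: 1; 4; 2; 3], [:: 12; 15; 9; 7]);
      ([:: 2; 14; 13; 1], [:: 6; 11; 7; 8], [:: 10; 13; 11; 5]);
      ([:: 6; 10; 7; 5], [:: 14; 5; 12; 0], [:: 6; 4; 3; 14]);
      ([:: 12; 9; 8; 11], [:: 9; 13; 15; 10], [:: 0; 2; 8; 1])].
Definition clique_5_5_5_5 : seq cycle3 :=
  [:: ([:: 3; 0; 1; 2; 4], [:: 4; 1; 3; 2; 0], [:: 8; 6; 15; 1; 14]);
      ([:: 16; 8; 10; 19; 7], [:: 15; 14; 7; 9; 12], [:: 3; 11; 5; 18; 13]);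
      ([:: 9; 11; 15; 18; 17], [:: 5; 8; 19; 11; 16], [:: 9; 4; 16; 17; 2]);
      ([:: 5; 6; 14; 12; 13], [:: 6; 18; 10; 13; 17], [:: 0; 7; 10; 12; 19])].
Definition clique_3_3_3_3_4 : seq cycle3 :=
  [:: ([:: 12; 6; 5], [:: 7; 10; 13], [:: 2; 0; 3]);
      ([:: 15; 10; 14], [:: 15; 9; 12], [:: 9; 13; 14]);
      ([:: 11; 8; 13], [:: 14; 5; 8], [:: 4; 5; 1]);
      ([:: 3; 9; 4], [:: 11; 1; 3], [:: 8; 10; 12]);
      ([:: 2; 7; 0; 1], [:: 0; 6; 2; 4], [:: 7; 6; 15; 11])].
Definition triple_5_5 : seq cycle3 :=
  [:: ([:: 1; 3; 8; 0; 5], [:: 5; 8; 7; 2; 3], [:: 0; 2; 4; 5; 7]);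
      ([:: 4; 7; 6; 2; 9], [:: 1; 4; 0; 6; 9], [:: 9; 3; 6; 1; 8])].
Definition no_triple_5_5 : seq cycle3 :=
  [:: ([:: 7; 9; 0; 3; 5], [:: 1; 4; 9; 2; 3], [:: 2; 0; 1; 6; 8]);
      ([:: 4; 8; 1; 2; 6], [:: 0; 7; 8; 5; 6], [:: 5; 4; 7; 3; 9])].

(** * Packings with and without a clique *)

Definition K4 := iota 0 4.
Definition K5 := iota 0 5.

Ltac grow_free q := refine (@realizable_grow_free q _ _ _ _ _); [by vm_compute.. |].
Ltac grow_clique k q :=
  refine (@realizable_grow_clique k K5 q _ _ _ _ _ _ _); [by vm_compute.. | |].

(** For sorted lengths a few comparisons decide which explicit packing is termwise below them. *)
Lemma sorted_case (P : seq nat -> Prop) ns :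
    (forall ms ms', perm_eq ms ms' -> P ms -> P ms') ->
  (sorted leq (sort leq ns) -> P (sort leq ns)) -> P ns.
Proof.
move=> Pperm Psort; apply: Pperm (permEl (perm_sort leq ns)) (Psort _).
exact: sort_sorted leq_total ns.
Qed.

(** Up to five cycles grow from an explicit packing. Four or five triangles need their own, since
    any split leaves a part with at most six vertices, which has no packing. From six cycles on,
    both parts of a split have at least three cycles, hence at least nine vertices. *)
Lemma realizable_free5 ns : all (leq 3) ns -> 8 <= sumn ns -> realizable ns true 5 false.
Proof.
have [n] := ubnP (size ns); elim: n ns => // n IHn ns; pattern ns.
apply: sorted_case => [ms ms' mm' | ].
  rewrite -(perm_all _ mm') -(perm_sumn mm') -(perm_size mm') => H n_ms ms3 sum_ms.
  exact: realizable_perm mm' (H n_ms ms3 sum_ms).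
case: (sort leq ns) => [|a [|b [|c [|d [|e [|f ms]]]]]] //= => abc n_ms ms3 sum_ms.
- by grow_free free_8; rewrite /=; lia.
- have [a3 | a4] := leqP a 3; first by grow_free free_3_5; rewrite /=; lia.
  by grow_free free_4_4; rewrite /=; lia.
- by grow_free free_3_3_3; rewrite /=; lia.
- by grow_free free_3_3_3_3; rewrite /=; lia.
- by grow_free free_3_3_3_3_3; rewrite /=; lia.
case/and3P: (ms3) => a3 b3 /and5P[c3 d3 e3 f3 ms_3].
apply: (@realizable_cat [:: a; b; c] (d :: e :: f :: ms) 4 false false).
  by apply: IHn; rewrite /= ?a3 ?b3 ?c3; lia.
by apply: IHn; rewrite /= ?d3 ?e3 ?f3 //; lia.
Qed.

Ltac given_clique K q := refine (@realizable_homog q _ K _ _); by vm_compute.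
Ltac given_free q := refine (@realizable_free q _ _ _ _); by vm_compute.

Definition packable ns := exists h, realizable ns true 5 h.

Lemma packable_perm ns ms : perm_eq ns ms -> packable ns -> packable ms.
Proof. by move=> nm [h rns]; exists h; apply: realizable_perm nm rns. Qed.

Lemma packable_ge7 ns : all (leq 3) ns -> 7 <= sumn ns -> packable ns.
Proof.
move=> ns3; rewrite leq_eqVlt => /orP[/eqP | sum8]; last first.
  by exists false; apply: realizable_free5.
move: ns3; pattern ns; apply: sorted_case => [ms ms' mm' | ].
  rewrite -(perm_all _ mm') -(perm_sumn mm') => H all3 sum7.
  exact: packable_perm mm' (H all3 sum7).
(* In order 7 the sum is complete, so the bit is [true]. *)
case: (sort leq ns) => [|a [|b [|c ms]]] //= abc ms3 sum7; last by lia.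
  have -> : a = 7 by lia.
  by exists true; given_clique K5 clique_7.
have [-> ->] : a = 3 /\ b = 4 by split; lia.
by exists true; given_clique K5 clique_3_4.
Qed.

Lemma realizable_clique_cat ns ms :
  realizable ns true 5 true -> packable ms -> realizable (ns ++ ms) true 5 true.
Proof. by move=> rns [h rms]; apply: (realizable_cat rns rms). Qed.

(** Given the bound on the sum, [6 <= b] excludes only [[:: 5; 5]]. Every remaining pair lies above
    3, 7 or 4, 6 or 5, 6. *)
Lemma clique5_pair a b : 3 <= a <= b -> 10 <= a + b -> 6 <= b ->
  realizable [:: a; b] true 5 true.
Proof.
case: (ltngtP a 4) => a4 a_b sum_ab b6.
- by grow_clique 0 clique_3_7; rewrite //=; lia.
- by grow_clique 0 clique_5_6; rewrite //=; lia.
by grow_clique 0 clique_4_6; rewrite //=; lia.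
Qed.

(** In the packings used for a shortest length 3 or 4, a copy of the first cycle lies in the clique,
    so this length must match exactly. From 5 on all three cycles grow from 5, 5, 6, which leaves
    only 5, 5, 5. *)
Lemma clique5_triple ns : size ns = 3 -> all (leq 3) ns -> has (leq 4) ns ->
  realizable ns true 5 true.
Proof.
pattern ns; apply: sorted_case => [ms ms' mm' | ].
  rewrite -(perm_all _ mm') -(perm_has _ mm') -(perm_size mm') => H *.
  exact: realizable_perm mm' (H _ _ _).
case: (sort leq ns) => [|a [|b [|c [|]]]] //= abc _ abc3 abc4.
have [a4 | a4 | a_eq] := ltngtP a 4.
- have a_eq : a = 3 by lia.
    by subst a; grow_clique 1 clique_3_3_4; rewrite /= ?eqxx //; lia.
- have [c5 | c6] := leqP c 5; last by grow_clique 0 clique_5_5_6; rewrite //=; lia.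
  have [-> -> ->] : [/\ a = 5, b = 5 & c = 5] by split; lia.
  given_clique K5 clique_5_5_5.
by subst a; grow_clique 1 clique_4_4_4; rewrite /= ?eqxx //; lia.
Qed.

Lemma realizable_clique5 ns : all (leq 3) ns -> 10 <= sumn ns ->
  has (leq 4) ns -> ~~ perm_eq ns [:: 5; 5] -> realizable ns true 5 true.
Proof.
pose P ms := all (leq 3) ms -> 10 <= sumn ms -> has (leq 4) ms -> ~~ perm_eq ms [:: 5; 5] ->
  realizable ms true 5 true.
rewrite -/(P ns); apply: sorted_case => [ms ms' mm' | ].
  rewrite /P -(perm_all _ mm') -(perm_has _ mm') -(perm_sumn mm') -(permPl mm') => H *.
  exact: realizable_perm mm' (H _ _ _ _).
rewrite /P; case: (sort leq ns) => [|a [|b [|c [|d [|e [|f ms]]]]]] //=;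
  move=> abc ms3 sum_ms ms4 ms55.
- by grow_clique 0 clique_10; rewrite //=; lia.
- apply: clique5_pair; [lia | lia |].
  rewrite ltnNge; apply: contra ms55 => b5.
  have [-> ->] : a = 5 /\ b = 5 by split; lia.
  exact: perm_refl.
- by apply: clique5_triple; rewrite //=; lia.
- have [a4 | a4 | a_eq] := ltngtP a 4.
  + have a_eq : a = 3 by lia.
    by subst a; grow_clique 1 clique_3_3_3_4; rewrite /= ?eqxx //; lia.
  + have [d5 | d6] := leqP d 5.
      have [-> -> -> ->] : [/\ a = 5, b = 5, c = 5 & d = 5] by split; lia.
      given_clique K5 clique_5_5_5_5.
    have ab : packable [:: a; b] by apply: packable_ge7; rewrite /=; lia.
    have cd : realizable [:: c; d] true 5 true by apply: clique5_pair; lia.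
    by apply: realizable_perm (realizable_clique_cat cd ab); rewrite perm_catC.
  by subst a; grow_clique 1 clique_4_4_4_4; rewrite /= ?eqxx //; lia.
- have [d3 | d4] := leqP d 3.
    have a_eq : a = 3 by lia.
    by subst a; grow_clique 1 clique_3_3_3_3_4; rewrite /= ?eqxx //; lia.
  (* The clique comes from the triple with the longest cycle; the other two cycles have at least 3 +
     4 vertices, enough for a packing. *)
  have abe : realizable [:: a; b; e] true 5 true by apply: clique5_triple; rewrite //=; lia.
  have cd : packable [:: c; d] by apply: packable_ge7; rewrite /=; lia.
  apply: realizable_perm (realizable_clique_cat abe cd).
  by apply/permP => x; rewrite /=; lia.
(* One cycle of length at least 4 and any two others carry the clique. At least three cycles remain,
   hence nine vertices or more. *)
have [x x_ms x4] : exists2 x, x \in [:: a, b, c, d, e, f & ms] & 4 <= x by apply/hasP.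
have /perm_to_rem x_rem := x_ms.
move: x_rem; set r := rem x _ => x_rem.
have sz_r : size r = (size ms).+3.+2 by rewrite size_rem.
case: r sz_r x_rem => [|y [|z r]] //= [sz_r] x_rem.
have r3 : all (leq 3) [:: x, y, z & r] by rewrite -(perm_all _ x_rem).
case/and4P: r3 => x3 y3 z3 r3.
have xyz : realizable [:: x; y; z] true 5 true.
  by apply: clique5_triple; rewrite //= ?x3 ?y3 ?z3 ?x4.
rewrite perm_sym in x_rem; apply: realizable_perm x_rem (realizable_clique_cat xyz _).
apply: packable_ge7 => //.
case: r sz_r r3 => [|u [|v [|w r]]] //= _; lia.
Qed.

(** Three, four and five triangles suffice as a basis, because further triangles are added by
    threes. *)
Lemma realizable_free4_nseq k : 3 <= k -> realizable (nseq k 3) true 4 false.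
Proof.
have [n] := ubnP k; elim: n k => // n IHn [|[|[|[|[|[|k]]]]]] //= k_n _.
- given_free free_3_3_3.
- given_free free_3_3_3_3.
- given_free free_3_3_3_3_3.
apply: (@realizable_cat (nseq 3 3) (nseq k.+3 3) 3 false false).
  given_free free_3_3_3.
by apply: IHn => //; lia.
Qed.

(** The sum for three triangles is K_{3,3,3}, which has no K_4. Six triangles therefore cannot be
    obtained as 3 + 3 and join four and five as a basis. *)
Lemma realizable_clique4_nseq k : 4 <= k -> realizable (nseq k 3) true 4 true.
Proof.
have [n] := ubnP k; elim: n k => // n IHn [|[|[|[|[|[|[|k]]]]]]] //= k_n _.
- given_clique K4 clique_3_3_3_3.
- given_clique K4 clique_3_3_3_3_3.
- given_clique K4 clique_3_3_3_3_3_3.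
apply: (@realizable_cat (nseq 3 3) (nseq k.+4 3) 3 false true).
  given_free free_3_3_3.
by apply: IHn => //; lia.
Qed.

Lemma two_realizations ns : all (leq 3) ns -> 9 <= sumn ns -> ~~ perm_eq ns [:: 3; 3; 3] ->
  exists b q, realizable ns b q true /\ realizable ns b q false.
Proof.
move=> ns3 sum9 ns333.
have [ns4 | /hasPn ns_le3] := boolP (has (leq 4) ns); last first.
  have ns_eq : ns = nseq (size ns) 3.
    apply/all_pred1P/allP => x xns; rewrite /= eqn_leq (allP ns3) // andbT leqNgt.
    exact: ns_le3.
  have size4 : 4 <= size ns.
    case: (size ns) ns_eq => [|[|[|[|k]]]] // ns_eq; move: sum9 ns333; by rewrite ns_eq.
  exists true, 4; rewrite ns_eq; split; first exact: realizable_clique4_nseq.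
  by apply: realizable_free4_nseq; apply: ltnW.
have [sum10 | sum_lt10] := leqP 10 (sumn ns).
  have [/permPl ns55 | ns55] := boolP (perm_eq ns [:: 5; 5]); last first.
    exists true, 5; split; first exact: realizable_clique5.
    by apply: realizable_free5 => //; apply: ltnW (ltnW sum10).
  have perm55 : perm_eq [:: 5; 5] ns by rewrite perm_sym ns55.
  exists false, 3; split; apply: realizable_perm perm55 _.
    given_clique [:: 4; 6; 8] triple_5_5.
  given_free no_triple_5_5.
exists true, 4; move: ns3 ns4 {ns333} sum9 sum_lt10.
pattern ns; apply: sorted_case => [ms ms' mm' | ].
  rewrite -(perm_all _ mm') -(perm_has _ mm') -(perm_sumn mm') => H ms3 ms4 ge9 lt10.
  by have [] := H ms3 ms4 ge9 lt10; split; apply: realizable_perm mm' _.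
case: (sort leq ns) => [|a [|b [|c ms]]] //= abc ms3 ms4 ge9 lt10; [ | |
  by case: ms abc ms3 ms4 ge9 lt10 => [|d ms] /=; lia].
  have -> : a = 9 by lia.
  by split; [given_clique K4 clique_9 | given_free free_9].
have [a4 | a3] := leqP 4 a.
  have [-> ->] : a = 4 /\ b = 5 by split; lia.
  by split; [given_clique K4 clique_4_5 | given_free free_4_5].
have [-> ->] : a = 3 /\ b = 6 by split; lia.
by split; [given_clique K4 clique_3_6 | given_free free_3_6].
Qed.

(** * Degrees and non-adjacency in a packing *)

Lemma set2_eq (T : finType) (a b c d : T) :
  ([set a; b] == [set c; d]) = ((a == c) && (b == d)) || ((a == d) && (b == c)).
Proof.
apply/eqP/idP => [abcd | /orP[]/andP[/eqP-> /eqP->] //]; last by rewrite setUC.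
have [/set2P a_cd /set2P b_cd] : a \in [set c; d] /\ b \in [set c; d].
  by rewrite -abcd !inE !eqxx orbT.
have [/set2P c_ab /set2P d_ab] : c \in [set a; b] /\ d \in [set a; b].
  by rewrite abcd !inE !eqxx orbT.
by case: a_cd b_cd c_ab d_ab => -> [] -> [] ? [] ?; subst; rewrite !eqxx ?orbT.
Qed.

Lemma image_edges_inj (V W : finType) (f : V -> W) (G : sgraph V) x y : injective f ->
  ([set f x; f y] \in image_edges f G) = ([set x; y] \in edges G).
Proof.
move=> f_inj; rewrite -(imset_set1 f x) -(imset_set1 f y) -imsetU.
by apply/imsetP/idP => [[e Ge /(imset_inj f_inj)->] | Gxy] //; exists [set x; y].
Qed.

Lemma edge_irrefl (V : finType) (G : sgraph V) x : [set x; x] \notin edges G.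
Proof. by apply/negP => /card_edge; rewrite cards2 eqxx. Qed.

Lemma edge_sym (V : finType) (G : sgraph V) x y :
  ([set x; y] \in edges G) = ([set y; x] \in edges G).
Proof. by rewrite setUC. Qed.

Lemma iso_card (V W : finType) (G : sgraph V) (H : sgraph W) : iso G H -> #|V| = #|W|.
Proof. by case=> f /bij_eq_card. Qed.

(** The two sides are the values of [ordS] and [ord_pred]: the neighbours on a cycle, which would
    coincide for [m = 2]. *)
Lemma modn_succ_neq_pred k m : k < m -> 2 < m -> k.+1 %% m != (k + m).-1 %% m.
Proof.
move=> k_m m3.
have -> : (k + m).-1 %% m = if k == 0 then m.-1 else k.-1.
  case: eqP => [-> | k0]; first by rewrite add0n modn_small //; lia.
  by rewrite (_ : (k + m).-1 = k.-1 + m) ?modnDr ?modn_small //; lia.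
have -> : k.+1 %% m = if k.+1 == m then 0 else k.+1.
  by case: eqP => [-> | km]; rewrite ?modnn // modn_small //; lia.
by apply/eqP; do 2!case: eqP => ?; lia.
Qed.

Section Cycles.
Variable ns : seq nat.
Hypothesis ns3 : all (leq 3) ns.
Let V : finType := {i : 'I_(size ns) & 'I_(nth 0 ns i)}.

Definition csucc (x : V) : V :=
  Tagged (fun i : 'I_(size ns) => 'I_(nth 0 ns i)) (ordS (tagged x)).
Definition cpred (x : V) : V :=
  Tagged (fun i : 'I_(size ns) => 'I_(nth 0 ns i)) (ord_pred (tagged x)).

Lemma csuccK : cancel csucc cpred.
Proof. by case=> i k; rewrite /csucc /cpred /= ordSK. Qed.

Lemma cpredK : cancel cpred csucc.
Proof. by case=> i k; rewrite /csucc /cpred /= ord_predK. Qed.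

Lemma len_ge3 (i : 'I_(size ns)) : 3 <= nth 0 ns i.
Proof. by apply: (allP ns3); rewrite mem_nth. Qed.

Lemma csucc_neq x : x != csucc x.
Proof.
case: x => i k; rewrite eq_sym eq_Tagged /= -val_eqE /=.
have m3 := len_ge3 i; move: (ltn_ord k); rewrite leq_eqVlt => /orP[/eqP km | km].
  by rewrite km modnn; lia.
by rewrite modn_small //; lia.
Qed.

Lemma csucc_neq_cpred x : csucc x != cpred x.
Proof.
by case: x => i k; rewrite eq_Tagged -val_eqE; apply: modn_succ_neq_pred (len_ge3 i).
Qed.

Lemma cycles_edge (x y : V) :
  ([set x; y] \in edges (cycles ns)) = (y == csucc x) || (x == csucc y).
Proof.
apply/bigcupP/idP => [[i _ /imsetP[_ /imsetP[k _ ->] xy]] | xy].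
  pose z : V := existT _ i k.
  have : [set x; y] == [set z; csucc z] by rewrite xy imsetU !imset_set1.
  by rewrite set2_eq => /orP[]/andP[/eqP-> /eqP->]; rewrite eqxx ?orbT.
wlog {xy} -> : x y / y = csucc x.
  move=> W; case/orP: xy => /eqP xy; first exact: W.
  by rewrite setUC; apply: W.
exists (tag x) => //; case: x => i k /=; apply/imsetP.
exists [set k; ordS k]; last by rewrite imsetU !imset_set1.
apply/imsetP; exists k => //; rewrite inE.
by have := csucc_neq (existT _ i k); rewrite eq_sym eq_Tagged eq_sym.
Qed.

Lemma cycles_edgeE (x y : V) :
  ([set x; y] \in edges (cycles ns)) = (y \in [set csucc x; cpred x]).
Proof.
rewrite cycles_edge !inE; congr (_ || _).
by rewrite eq_sym (can2_eq (@csuccK) (@cpredK)).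
Qed.

Lemma card_cycles : #|V| = sumn ns.
Proof.
rewrite card_tagged; congr sumn; rewrite -[RHS](mkseq_nth 0) /mkseq -val_enum_ord -map_comp.
by apply: eq_map => i; rewrite /= card_ord.
Qed.

Section Degree.
Variable a : packing3 (cycles ns).

Lemma copy_map_bij i : bijective (copy_map a i).
Proof. by apply: inj_card_bij (copy_inj (p := a) (i := i)) _; rewrite card_ord. Qed.

Definition copy_nbrs i X := [set Y | [set X; Y] \in edges (packed_copy a i)].

Lemma card_copy_nbrs i X : #|copy_nbrs i X| = 2.
Proof.
have [g _ gK] := copy_map_bij i; have f_inj := copy_inj (p := a) (i := i).
rewrite -(gK X); set x := g X.
suff -> : copy_nbrs i (copy_map a i x) = copy_map a i @: [set csucc x; cpred x].
  by rewrite card_imset // cards2 csucc_neq_cpred.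
apply/setP => Y; rewrite -(gK Y) mem_imset // inE image_edges_inj //.
by rewrite cycles_edgeE.
Qed.

Lemma edge_packing_sum X Y : ([set X; Y] \in edges (packing_sum a)) =
  [exists i, [set X; Y] \in edges (packed_copy a i)].
Proof.
rewrite !inE; apply/idP/existsP => [/orP[/orP[]|] e_i | [[[|[|[|//]]] lt_i] e_i]].
- by exists (inord 0).
- by exists (inord 1).
- by exists (inord 2).
- by rewrite (_ : inord 0 = Ordinal lt_i) ?e_i //; apply: val_inj; rewrite /= inordK.
- by rewrite (_ : inord 1 = Ordinal lt_i) ?e_i ?orbT //; apply: val_inj; rewrite /= inordK.
- by rewrite (_ : inord 2 = Ordinal lt_i) ?e_i ?orbT //; apply: val_inj; rewrite /= inordK.
Qed.

Lemma copies_disjoint i j X Y : [set X; Y] \in edges (packed_copy a i) ->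
  [set X; Y] \in edges (packed_copy a j) -> i = j.
Proof.
move=> Xi Xj; apply/eqP/negPn/negP => /(copy_disjoint a)/setP/(_ [set X; Y]).
by rewrite inE [_ \in set0]inE => /negbT/negP[]; apply/andP.
Qed.

Definition sum_nbrs X := [set Y | [set X; Y] \in edges (packing_sum a)].

(** Each copy contributes two neighbours, and edge-disjointness keeps the three pairs disjoint. *)
Lemma card_sum_nbrs X : #|sum_nbrs X| = 6.
Proof.
have -> : sum_nbrs X = \bigcup_i copy_nbrs i X.
  apply/setP => Y; rewrite inE edge_packing_sum.
  apply/existsP/bigcupP => [[i Xi] | [i _ Xi]]; exists i => //; first by rewrite inE.
  by rewrite inE in Xi.
rewrite -sum1_card partition_disjoint_bigcup => [|i j ij].
  transitivity (\sum_(i < 3) 2); last by rewrite sum_nat_const card_ord.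
  by apply: eq_bigr => i _; rewrite sum1_card card_copy_nbrs.
rewrite -setI_eq0; apply: contraNT ij => /set0Pn[Y /setIP[]].
by rewrite !inE => Yi Yj; apply/eqP; apply: copies_disjoint Yi Yj.
Qed.

Lemma order_gt6 : 0 < size ns -> 6 < sumn ns.
Proof.
move=> ns0; have m0 := ltnW (ltnW (len_ge3 (Ordinal ns0))).
pose X := copy_map a ord0 (existT _ (Ordinal ns0) (Ordinal m0)).
suff : #|sum_nbrs X| < #|[set: 'I_#|V|]|.
  by rewrite card_sum_nbrs cardsT card_ord card_cycles.
apply: proper_card; apply/properP; split; first exact: subsetT.
by exists X; rewrite in_set ?edge_irrefl.
Qed.

(** This includes equality: [[set X; X]] has one element and is never an edge. *)
Definition nonadj X Y := [set X; Y] \notin edges (packing_sum a).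

Lemma card_nonadj X : #|[set Y | nonadj X Y]| = sumn ns - 6.
Proof.
have -> : [set Y | nonadj X Y] = ~: sum_nbrs X.
  by apply/setP => Y; rewrite in_setC [LHS]in_set [Y \in sum_nbrs X]in_set.
by rewrite cardsCs setCK card_sum_nbrs card_ord card_cycles.
Qed.

Lemma nonadj_refl X : nonadj X X. Proof. exact: edge_irrefl. Qed.

Lemma nonadj_sym X Y : nonadj X Y = nonadj Y X. Proof. by rewrite /nonadj edge_sym. Qed.
End Degree.

End Cycles.

(** * Equivalence relations with classes of equal size *)

(** An element is coded by the number of its class and its rank inside the class. Classes of the
    same size are equally many for [R] and [S], so both have the same codes, and [f] matches
    elements with equal codes. *)
Lemma equivalence_bij (T : finType) (R S : rel T) d :
    equivalence_rel R -> equivalence_rel S ->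
    (forall x, #|[set y | R x y]| = d) -> (forall x, #|[set y | S x y]| = d) ->
  exists2 f, bijective f & forall x y, S (f x) (f y) = R x y.
Proof.
pose cls (Q : rel T) x := [set y | Q x y].
pose P (Q : rel T) := [set cls Q x | x : T].
pose code Q x := (index (cls Q x) (enum (P Q)), index x (enum (cls Q x))).
have clsE Q : equivalence_rel Q -> forall x y, (cls Q x == cls Q y) = Q x y.
  move=> eqQ x y; apply/eqP/idP => [/setP/(_ y) | xy].
    by rewrite !inE => ->; case: (eqQ y y y).
  by apply/setP => z; rewrite !inE; case: (eqQ x y z) => _ ->.
have code1 Q : equivalence_rel Q -> forall x y, ((code Q x).1 == (code Q y).1) = Q x y.
  move=> eqQ x y; rewrite -clsE //=; apply/eqP/eqP => [|-> //].
  by move/(index_inj set0); apply; rewrite mem_enum imset_f.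
have code_inj Q : equivalence_rel Q -> injective (code Q).
  move=> eqQ x y xy; have := congr1 fst xy => /eqP; rewrite code1 // -clsE // => /eqP cl.
  have := congr1 snd xy; rewrite /= cl => /(index_inj x); apply; rewrite mem_enum inE.
    by rewrite -clsE // cl.
  by case: (eqQ y y y).
have cardP Q : equivalence_rel Q -> (forall x, #|cls Q x| = d) -> #|P Q| * d = #|T|.
  move=> eqQ cardQ; rewrite -cardsT; apply/esym.
  apply: card_uniform_partition => [_ /imsetP[x _ ->] // |].
  have := equivalence_partitionP (R := Q) (D := setT) (fun x y z _ _ _ => eqQ x y z).
  rewrite /equivalence_partition (_ : [set _ | x in _] = P Q) //.
  have clsT x : [set y in setT | Q x y] = cls Q x by apply/setP => y; rewrite !inE.
  by apply/setP => A; apply/imsetP/imsetP => -[x _ ->]; exists x; rewrite // clsT.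
move=> eqR eqS cardR cardS.
have surj x : exists y, code S y == code R x.
  have d0 : 0 < d.
    by rewrite -(cardR x); apply/card_gt0P; exists x; rewrite inE; case: (eqR x x x).
  have PRS : #|P R| = #|P S|.
    by apply/eqP; rewrite -(eqn_pmul2r d0) !cardP.
  have iS : index (cls R x) (enum (P R)) < size (enum (P S)).
    by rewrite -cardE -PRS cardE index_mem mem_enum imset_f.
  have : nth set0 (enum (P S)) (index (cls R x) (enum (P R))) \in P S.
    by rewrite -mem_enum mem_nth.
  case/imsetP => z _ zE.
  have jS : index x (enum (cls R x)) < size (enum (cls S z)).
    rewrite -cardE cardS -(cardR x) cardE index_mem mem_enum inE.
    by case: (eqR x x x).
  exists (nth x (enum (cls S z)) (index x (enum (cls R x)))); rewrite /code.
  set y := nth _ _ _; have : y \in cls S z by rewrite -mem_enum mem_nth.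
  rewrite inE -clsE // => /eqP <-.
  have -> : index (cls S z) (enum (P S)) = index (cls R x) (enum (P R)).
    by rewrite -zE index_uniq ?enum_uniq.
  by rewrite /y index_uniq ?enum_uniq.
pose f x := xchoose (surj x).
have fE x : code S (f x) = code R x := eqP (xchooseP (surj x)).
exists f => [|x y]; last by rewrite -code1 // !fE code1.
by apply: injF_bij => x y fxy; apply: (code_inj R) => //; rewrite -!fE fxy.
Qed.

Lemma equivalence_of (T : Type) (R : rel T) :
  reflexive R -> symmetric R -> transitive R -> equivalence_rel R.
Proof.
move=> Rr Rs Rt; apply/equivalence_relP; split=> //.
exact: sym_left_transitive.
Qed.

(** A failure of transitivity at distinct [x], [y], [z] would put all three into the class of
    [y]. *)
Lemma small_class_trans (T : finType) (R : rel T) : reflexive R -> symmetric R ->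
  (forall x, #|[set y | R x y]| <= 2) -> transitive R.
Proof.
move=> Rr Rs R2 y x z xy yz.
have [xyE | xy'] := eqVneq x y; first by rewrite xyE.
have [yzE | yz'] := eqVneq y z; first by rewrite -yzE.
have [-> // | xz] := eqVneq x z.
have sub : [set y; x; z] \subset [set u | R y u].
  by apply/subsetP => u /setUP[/set2P[]|/set1P] ->; rewrite inE // Rs.
have := leq_trans (subset_leq_card sub) (R2 y).
by rewrite -setUA cardsU1 cards2 !inE xz negb_or eq_sym xy' yz'.
Qed.

(* Three pairwise orthogonal partitions of nine points into triples leave a
   fourth one: two classes from different partitions always meet, so if [x] is
   unrelated to [y] and [z], which are related by [R i], then the third member
   of their class is related to [x] by the other two relations. *)
Section NinePoints.
Variables (T : finType) (R : 'I_3 -> rel T).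
Hypotheses (card_T : #|T| = 9) (equivR : forall i, equivalence_rel (R i)).
Hypothesis card_R : forall i x, #|[set y | R i x y]| = 3.
Hypothesis orthR : forall i j x y, R i x y -> R j x y -> x != y -> i = j.

Let Rrefl i x : R i x x. Proof. by case: (equivR i x x x). Qed.
Let Rleft i x y z : R i x y -> R i x z = R i y z.
Proof. by case: (equivR i x y z). Qed.
Let Rsym i x y : R i x y = R i y x.
Proof. by apply/idP/idP => xy; rewrite -(Rleft _ xy). Qed.

(** The three members of the [R j]-class of [x] lie in different classes of [R i] by orthogonality.
    As [R i] has 9 / 3 = 3 classes, all of them are hit. *)
Lemma classes_meet i j x y : i != j -> exists2 u, R i y u & R j x u.
Proof.
move=> ij; pose cls x := [set y | R i x y]; pose P := [set cls x | x : T].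
have clsE u v : (cls u == cls v) = R i u v.
  apply/eqP/idP => [/setP/(_ v) | uv]; first by rewrite !inE Rrefl => ->.
  by apply/setP => w; rewrite !inE (Rleft _ uv).
have cardP : #|P| = 3.
  have : #|[set: T]| = #|P| * 3; last by rewrite cardsT card_T; lia.
  apply: card_uniform_partition => [_ /imsetP[z _ ->] | ]; first exact: card_R.
  have := equivalence_partitionP (R := R i) (D := setT) (fun x y z _ _ _ => equivR i x y z).
  rewrite /equivalence_partition (_ : [set _ | x in _] = P) //.
  have clsT u : [set v in setT | R i u v] = cls u by apply/setP => v; rewrite !inE.
  by apply/setP => A; apply/imsetP/imsetP => -[u _ ->]; exists u; rewrite // clsT.
have PE : cls @: [set u | R j x u] = P.
  apply/eqP; rewrite eqEcard; apply/andP; split.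
    by apply/subsetP => _ /imsetP[u _ ->]; apply: imset_f.
  rewrite cardP card_in_imset ?card_R //.
  move=> u v; rewrite !inE => xu xv /eqP; rewrite clsE => uv.
  apply/eqP/negPn/negP => /(orthR uv) ji; case/negP: ij; apply/eqP/ji.
  by rewrite -(Rleft _ xu).
have : cls y \in P by apply: imset_f.
rewrite -PE => /imsetP[u xu /eqP]; rewrite clsE => yu; exists u => //.
by rewrite inE in xu.
Qed.

Let S x y := (x == y) || [forall i, ~~ R i x y].

Lemma unrelated_trans : transitive S.
Proof.
have Ssym x y : S x y -> S y x.
  case/orP => [/eqP-> | /forallP xy]; rewrite /S ?eqxx //.
  by apply/orP; right; apply/forallP => i; rewrite Rsym.
move=> x y z /Ssym xy xz.
have [xyE | xyN] := eqVneq x y; first by rewrite -xyE.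
have [xzE | xzN] := eqVneq x z; first by rewrite -xzE; apply: Ssym.
move: xy xz; rewrite /S (negbTE xyN) (negbTE xzN) /= => /forallP xy /forallP xz.
apply/orP; case: eqVneq => [|yz]; first by left.
right; apply/forallP => i; apply/negP => Ryz.
have meet j : i != j -> exists u, [/\ R i y u, R j x u, u != y & u != z].
  move=> ij; have [u yu xu] := classes_meet x y ij; exists u; split=> //.
    by apply: contraTneq xu => ->.
  by apply: contraTneq xu => ->.
have [j [k [ij ik jk]]] : exists j k, [/\ i != j, i != k & j != k].
  case: (i) => -[|[|[|//]]] lt_i.
  - by exists (inord 1), (inord 2); rewrite -!val_eqE /= !inordK.
  - by exists (inord 0), (inord 2); rewrite -!val_eqE /= !inordK.
  - by exists (inord 0), (inord 1); rewrite -!val_eqE /= !inordK.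
have [u [yu xu uy uz]] := meet j ij; have [v [yv xv vy vz]] := meet k ik.
have uv : u = v.
  apply/eqP/negPn/negP => uv.
  have sub : [set y; z; u; v] \subset [set w | R i y w].
    apply/subsetP => w; rewrite !inE -!orbA => /or4P[] /eqP-> //.
  have := subset_leq_card sub; rewrite card_R.
  rewrite -!setUA !cardsU1 cards1 !inE !negb_or yz.
  by rewrite eq_sym uy eq_sym vy uv eq_sym uz eq_sym vz.
subst v; case/negP: jk; apply/eqP/(orthR xu xv).
by apply: contraNneq (xy i) => ->; rewrite Rsym.
Qed.
End NinePoints.

(** * Uniqueness in orders 7 and 8 and for three triangles *)

(** This form is invariant under isomorphism and says that adjacency together with equality is
    transitive. *)
Definition union_of_triangles (V : finType) (G : sgraph V) := forall x y z, x != z ->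
  [set x; y] \in edges G -> [set y; z] \in edges G -> [set x; z] \in edges G.

Lemma iso_triangles (V W : finType) (G : sgraph V) (H : sgraph W) :
  iso G H -> union_of_triangles H -> union_of_triangles G.
Proof.
case=> f /bij_inj f_inj fE tri x y z xz; rewrite -!fE; apply: tri.
by rewrite inj_eq.
Qed.

(** On a 3-cycle the predecessor is the successor of the successor. *)
Lemma cycles_triangles ns : all (pred1 3) ns -> union_of_triangles (cycles ns).
Proof.
move=> ns3; have ge3 : all (leq 3) ns by apply: sub_all ns3 => m /eqP->.
move=> x y z xz; rewrite edge_sym !cycles_edgeE // => xy yz.
suff yy : cpred y = csucc (csucc y).
  move: xy yz xz; rewrite !inE yy.
  do 2!(case/orP => /eqP->); rewrite ?eqxx ?csuccK ?eqxx ?orbT //.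
case: y {xy yz} => i k; apply/eqP; rewrite eq_Tagged -val_eqE /=.
have /eqP m3 : nth 0 ns i == 3 by apply: (allP ns3); rewrite mem_nth.
move: k; rewrite m3 => -[[|[|[|]]]] //.
Qed.

Section Uniqueness.
Variable ns : seq nat.
Hypothesis ns3 : all (leq 3) ns.
Implicit Types a b : packing3 (cycles ns).

Lemma packing_sum_iso a b : equivalence_rel (nonadj a) -> equivalence_rel (nonadj b) ->
  iso (packing_sum a) (packing_sum b).
Proof.
move=> eqa eqb.
have [f f_bij fE] := equivalence_bij eqa eqb (card_nonadj ns3 a) (card_nonadj ns3 b).
by exists f => // X Y; apply: negb_inj; apply: fE.
Qed.

Lemma nonadj_equivalence_small a : sumn ns <= 8 -> equivalence_rel (nonadj a).
Proof.
move=> n8; have Rr : reflexive (nonadj a) by apply: nonadj_refl.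
have Rs : symmetric (nonadj a) by apply: nonadj_sym.
apply: equivalence_of => //; apply: small_class_trans => // X.
by rewrite card_nonadj //; lia.
Qed.

Lemma nonadj_equivalence_triangles a : sumn ns = 9 -> union_of_triangles (cycles ns) ->
  equivalence_rel (nonadj a).
Proof.
move=> n9 tri.
(* The classes of [R i] are the triangles of copy [i], and orthogonality is edge-disjointness of the
   copies; non-adjacency is then the fourth relation on nine points. *)
pose R i X Y := (X == Y) || ([set X; Y] \in edges (packed_copy a i)).
have triR i : union_of_triangles (packed_copy a i).
  move=> X Y Z; have [g _ gK] := copy_map_bij a i.
  rewrite -(gK X) -(gK Y) -(gK Z) (inj_eq (copy_inj (p := a) (i := i))) => XZ.
  by rewrite !(image_edges_inj _ _ _ (copy_inj (p := a) (i := i))); apply: tri.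
have nonadjE X Y : nonadj a X Y = (X == Y) || [forall i, ~~ R i X Y].
  rewrite /R /nonadj edge_packing_sum; case: eqVneq => [-> | XY].
    by rewrite -edge_packing_sum edge_irrefl.
  by rewrite negb_exists.
apply: equivalence_of; [exact: nonadj_refl | exact: nonadj_sym |].
suff tS : transitive (fun X Y => (X == Y) || [forall i, ~~ R i X Y]).
  by move=> Y X Z; rewrite !nonadjE; apply: tS.
apply: unrelated_trans.
- by rewrite card_ord card_cycles.
- move=> i; apply: equivalence_of => [X | X Y | Y X Z].
  + by rewrite /R eqxx.
  + by rewrite /R eq_sym edge_sym.
  rewrite /R; case/orP => [/eqP-> // | XY].
  case/orP => [/eqP<- | YZ]; first by rewrite XY orbT.
  by case: eqVneq => //= XZ; apply: triR XZ XY YZ.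
- move=> i X; rewrite -[3]/(1 + 2) -(card_copy_nbrs ns3 a i X).
  have -> : [set Y | R i X Y] = X |: copy_nbrs a i X.
    apply/setP => Y.
    by rewrite [RHS]in_setU1 [Y \in copy_nbrs _ _ _]in_set [LHS]in_set eq_sym.
  by rewrite cardsU1 [X \in _]in_set edge_irrefl.
move=> i j X Y; rewrite /R => + + XY; rewrite (negbTE XY) /=.
exact: copies_disjoint.
Qed.
End Uniqueness.

(** * From lists to packings *)

(** Plain pairs of numbers avoid transport between the dependent vertex types of different lists. *)
Definition coord ns (x : {i : 'I_(size ns) & 'I_(nth 0 ns i)}) : nat * nat :=
  (val (tag x), val (tagged x)).

Lemma coord_inj ns : injective (@coord ns).
Proof.
move=> [i k] [j l] [/= ij kl]; have eq_ij : i = j by apply: val_inj.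
by subst j; congr existT; apply: val_inj.
Qed.

Lemma coord_csucc ns (x : {i : 'I_(size ns) & 'I_(nth 0 ns i)}) :
  coord (csucc x) = ((coord x).1, (coord x).2.+1 %% nth 0 ns (coord x).1).
Proof. by []. Qed.

Lemma coord_onto ns i k : i < size ns -> k < nth 0 ns i ->
  exists x : {i : 'I_(size ns) & 'I_(nth 0 ns i)}, coord x = (i, k).
Proof. by move=> lt_i lt_k; exists (existT _ (Ordinal lt_i) (Ordinal lt_k)). Qed.

(** Moving whole cycles and keeping the position within each commutes with [csucc], which determines
    adjacency. *)
Lemma cycles_iso_perm ns ms :
  all (leq 3) ns -> perm_eq ns ms -> iso (cycles ns) (cycles ms).
Proof.
move=> ns3 nm; have ms3 : all (leq 3) ms by rewrite -(perm_all _ nm).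
have /(perm_iotaP 0)[Is Is_perm ns_eq] := nm.
have sz_Is : size Is = size ns by rewrite ns_eq size_map.
have Is_lt i : i < size ns -> nth 0 Is i < size ms.
  move=> lt_i; have := mem_nth 0 (etrans (congr1 _ sz_Is) lt_i).
  by rewrite (perm_mem Is_perm) mem_iota.
have nthE i : i < size ns -> nth 0 ns i = nth 0 ms (nth 0 Is i).
  by move=> lt_i; rewrite ns_eq (nth_map 0) // sz_Is.
have ex_f (x : {i : 'I_(size ns) & 'I_(nth 0 ns i)}) :
    exists y : {i : 'I_(size ms) & 'I_(nth 0 ms i)},
      coord y == (nth 0 Is (coord x).1, (coord x).2).
  have [||y yE] := @coord_onto ms (nth 0 Is (coord x).1) (coord x).2.
  - exact: Is_lt (ltn_ord _).
  - by rewrite -nthE; [apply: ltn_ord | apply: ltn_ord].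
  by exists y; apply/eqP.
pose f x := xchoose (ex_f x); have fE x : coord (f x) = _ := eqP (xchooseP (ex_f x)).
have f_inj : injective f.
  move=> x y /(congr1 (@coord _)); rewrite !fE => -[/eqP eq1 eq2]; apply: coord_inj.
  move: eq1; rewrite nth_uniq ?sz_Is ?ltn_ord // ?(perm_uniq Is_perm) ?iota_uniq //.
  move=> /eqP eq1.
  by apply: injective_projections => //; rewrite eq1.
have fS x : f (csucc x) = csucc (f x).
  by apply: coord_inj; rewrite fE !coord_csucc !fE nthE // ltn_ord.
exists f => [|x y]; last by rewrite !cycles_edge // -!fS !inj_eq.
by apply: inj_card_bij f_inj _; rewrite !card_cycles (perm_sumn nm).
Qed.

Lemma mem_arcs (s : seq nat) u v : reflect
  (exists2 k, k < size s & u = nth 0 s k /\ v = nth 0 s (k.+1 %% size s))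
  ((u, v) \in arcs s).
Proof.
have sz : size (arcs s) = size s by rewrite size_zip size_rot minnn.
have nthE k : k < size s -> nth (0, 0) (arcs s) k = (nth 0 s k, nth 0 s (k.+1 %% size s)).
  move=> lt_k; rewrite nth_zip ?size_rot //; congr (_, _).
  case: s lt_k {sz} => // x s; rewrite rot1_cons nth_rcons /= !ltnS => lt_k.
  rewrite leq_eqVlt in lt_k; case/orP: lt_k => [/eqP-> | lt_k].
    by rewrite ltnn eqxx modnn.
  by rewrite lt_k modn_small.
apply: (iffP (nthP (0, 0))) => [[k] | [k lt_k [-> ->]]].
  by rewrite sz => lt_k; rewrite nthE // => -[<- <-]; exists k.
by exists k; rewrite ?sz ?nthE.
Qed.

Definition side i (t : cycle3) := match i with 0 => t.1.1 | 1 => t.1.2 | _ => t.2 end.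
Definition side_arcs i (p : seq cycle3) := flatten [seq arcs (side i t) | t <- p].

(** [links] is grouped by cycle, a packing by copy; this regroups. *)
Lemma links_sides p : perm_eq (links p)
  (symm (side_arcs 0 p) ++ symm (side_arcs 1 p) ++ symm (side_arcs 2 p)).
Proof.
elim: p => // t p IHp; rewrite links_cons; apply/permP => a; move/permP/(_ a): IHp.
rewrite /side_arcs /= /symm /arcs3 !map_cat !count_cat => ->; ring.
Qed.

Definition homogeneous (W : finType) (H : sgraph W) b q := exists K : seq W,
  [/\ uniq K, size K = q & {in K &, forall x y, x != y -> ([set x; y] \in edges H) = b}].

Section Realize.
Variables (V0 : seq nat) (p : seq cycle3).
Hypothesis V0p : packs V0 p.
Let ns := lens p.
Let V : finType := {i : 'I_(size ns) & 'I_(nth 0 ns i)}.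
Implicit Types (i : 'I_3) (x y : V) (X Y : 'I_#|V|).

Lemma lens_ge3 : all (leq 3) ns.
Proof.
case/and4P: V0p => _ _ bal _; apply/allP => _ /mapP[t /(allP bal)/and3P[t3 _ _] ->].
exact: t3.
Qed.

Let flat i := flatten [seq side i t | t <- p].

Lemma flat_perm i : perm_eq (flat i) V0.
Proof.
case/and4P: V0p => /and3P[p1 p2 p3] _ _ _.
by case: i => -[|[|[|//]]].
Qed.

Lemma side_shape i : shape [seq side i t | t <- p] = ns.
Proof.
case/and4P: V0p => _ _ bal _; rewrite /shape -map_comp; apply/eq_in_map => t /(allP bal).
by case/and3P => _ /eqP t1 /eqP t2; case: i => -[|[|[|//]]].
Qed.

Let pos x := flatten_index ns (coord x).1 (coord x).2.
Definition label i x := nth 0 (nth [::] [seq side i t | t <- p] (coord x).1) (coord x).2.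

(** The double index suits adjacency, the position in the flattened list suits injectivity: that
    list is a permutation of the duplicate-free [V0]. *)
Lemma label_flat i x : label i x = nth 0 (flat i) (pos x).
Proof. by rewrite nth_flatten side_shape flatten_indexKl ?flatten_indexKr // ltn_ord. Qed.

Lemma size_V0 : size V0 = #|V|.
Proof. by rewrite card_cycles -(perm_size (flat_perm ord0)) size_flatten side_shape. Qed.

Lemma pos_lt i x : pos x < size (flat i).
Proof. by rewrite size_flatten side_shape flatten_indexP // ltn_ord. Qed.

Lemma label_in i x : label i x \in V0.
Proof. by rewrite label_flat -(perm_mem (flat_perm i)) mem_nth ?pos_lt. Qed.

Lemma uniq_V0 : uniq V0. Proof. by case/and4P: V0p. Qed.

Lemma label_inj i : injective (label i).
Proof.
move=> x y /eqP; rewrite !label_flat.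
rewrite nth_uniq ?pos_lt ?(perm_uniq (flat_perm i)) ?uniq_V0 //.
move/eqP => xy; apply: coord_inj; apply: injective_projections.
  rewrite -(flatten_indexKl (sh := ns) (r := (coord x).1) (c := (coord x).2)) ?ltn_ord //.
  by rewrite -[flatten_index _ _ _]/(pos x) xy flatten_indexKl ?ltn_ord.
rewrite -(flatten_indexKr (sh := ns) (r := (coord x).1) (c := (coord x).2)) ?ltn_ord //.
by rewrite -[flatten_index _ _ _]/(pos x) xy flatten_indexKr ?ltn_ord.
Qed.

Lemma mem_side_arcs i x y : ((label i x, label i y) \in side_arcs i p) = (y == csucc x).
Proof.
have len_t t : t \in p -> size (side i t) = size t.2.
  case/and4P: V0p => _ _ /allP bal _ /bal/and3P[_ /eqP t1 /eqP t2].
  by case: i => -[|[|[|//]]].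
have lenE j : j < size p -> nth 0 ns j = size (nth ([::], [::], [::]) p j).2.
  by move=> lt_j; rewrite (nth_map ([::], [::], [::])).
apply/flatten_mapP/eqP => [[t /(nthP ([::], [::], [::]))[j lt_j <-] /mem_arcs[k]] | ->].
  set t' := nth _ _ _; have t'p : t' \in p by apply: mem_nth.
  rewrite len_t // => lt_k [xE yE].
  have [||z zE] := @coord_onto ns j k; rewrite ?size_map ?lenE //.
  have xz : x = z.
    by apply: (@label_inj i); rewrite xE /label zE (nth_map ([::], [::], [::])).
  subst z; apply: (@label_inj i).
  by rewrite yE /label coord_csucc zE (nth_map ([::], [::], [::])) // lenE.
have lt_x : (coord x).1 < size p by apply: leq_trans (ltn_ord (tag x)) _; rewrite size_map.
pose t := nth ([::], [::], [::]) p (coord x).1; have tp : t \in p by apply: mem_nth.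
exists t => //; apply/mem_arcs; exists (coord x).2.
  by rewrite len_t // -lenE // ltn_ord.
by rewrite /label coord_csucc len_t // -lenE // !(nth_map ([::], [::], [::])).
Qed.

Lemma copy_proof i x : index (label i x) V0 < #|V|.
Proof. by rewrite -size_V0 index_mem label_in. Qed.

(** Labels are arbitrary numbers; their index in [V0] gives vertices of the complete graph, and
    [point] goes back. *)
Definition copy i x : 'I_#|V| := Ordinal (copy_proof i x).
Definition point X := nth 0 V0 X.

Lemma copyK i x : point (copy i x) = label i x.
Proof. by rewrite /point nth_index ?label_in. Qed.

Lemma copy_injective i : injective (copy i).
Proof. by move=> x y xy; apply: (@label_inj i); rewrite -!copyK xy. Qed.

Lemma image_edge i X Y : ([set X; Y] \in image_edges (copy i) (cycles ns)) =
  ((point X, point Y) \in symm (side_arcs i p)).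
Proof.
have [g _ gK] : bijective (copy i).
  by apply: inj_card_bij (@copy_injective i) _; rewrite card_ord.
rewrite -(gK X) -(gK Y) image_edges_inj; last exact: copy_injective.
by rewrite cycles_edge ?lens_ge3 // !copyK mem_symm !mem_side_arcs.
Qed.

(** An edge common to two copies would occur twice in [links p]. *)
Lemma copy_edge_disjoint i j : i != j ->
  image_edges (copy i) (cycles ns) :&: image_edges (copy j) (cycles ns) = set0.
Proof.
move=> ij; apply/setP => e; rewrite inE [RHS]inE; apply/negP => /andP[ei ej].
have /cards2P[X [Y [_ eE]]] : #|e| == 2.
  by rewrite (card_image_edges (@copy_injective i) ei).
move: ei ej; rewrite eE !image_edge; set u := (_, _) => ui uj.
have /and4P[_ _ _] := V0p; rewrite (perm_uniq (links_sides p)).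
rewrite cat_uniq [uniq (symm _ ++ symm _)]cat_uniq.
case/and3P => _ /hasPn d12 /and3P[_ /hasPn d23 _].
have d01 : u \in symm (side_arcs 0 p) -> u \in symm (side_arcs 1 p) -> False.
  by move=> u0 u1; have := d12 u; rewrite mem_cat u1 /= u0 => /(_ isT).
have d02 : u \in symm (side_arcs 0 p) -> u \in symm (side_arcs 2 p) -> False.
  by move=> u0 u2; have := d12 u; rewrite mem_cat u2 orbT /= u0 => /(_ isT).
have d12' : u \in symm (side_arcs 1 p) -> u \in symm (side_arcs 2 p) -> False.
  by move=> u1 u2; have := d23 u u2; rewrite /= u1.
by case: i j ij ui uj => [[|[|[|//]]] ?] [[|[|[|//]]] ?] //= _ ui uj;
  solve [exact: (d01 ui uj) | exact: (d01 uj ui) | exact: (d02 ui uj) | exact: (d02 uj ui)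
        | exact: (d12' ui uj) | exact: (d12' uj ui)].
Qed.

Definition realize : packing3 (cycles ns) := Packing3 (@copy_injective) copy_edge_disjoint.

Lemma realize_edge X Y :
  ([set X; Y] \in edges (packing_sum realize)) = ((point X, point Y) \in links p).
Proof.
rewrite (perm_mem (links_sides p)) edge_packing_sum mem_cat [_ \in symm _ ++ symm _]mem_cat.
have E i : ([set X; Y] \in edges (packed_copy realize i)) =
    ((point X, point Y) \in symm (side_arcs i p)).
  exact: image_edge.
apply/existsP/or3P => [[i] | ].
  rewrite E; case: i => -[|[|[|//]]] /= _ e_i; [exact: Or31 | exact: Or32 | exact: Or33].
by case=> e_i; [exists (inord 0) | exists (inord 1) | exists (inord 2)]; rewrite E inordK.
Qed.

Lemma realize_homogeneous b q : homogeneous (packing_sum realize) b q <-> homog V0 p b q.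
Proof.
have point_in X : point X \in V0 by rewrite mem_nth // size_V0 ltn_ord.
have point_inj : injective point.
  move=> X Y /eqP; rewrite nth_uniq ?uniq_V0 ?size_V0 ?ltn_ord // => /eqP; exact: val_inj.
split=> [[K [uK sK Kb]] | [K [uK sK KV Kb]]].
  exists (map point K); rewrite map_inj_uniq // size_map; split=> //.
    by move=> _ /mapP[X _ ->].
  by move=> _ _ /mapP[X XK ->] /mapP[Y YK ->]; rewrite inj_eq // -realize_edge; apply: Kb.
have [L KE] : exists L, K = map point L.
  elim: (K) KV => [|x K' IHK] KV; first by exists [::].
  have [y yK|L ->] := IHK; first by apply: KV; rewrite inE yK orbT.
  have xV : x \in V0 by apply: KV; rewrite mem_head.
  have lt_x : index x V0 < #|V| by rewrite -size_V0 index_mem.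
  by exists (Ordinal lt_x :: L); rewrite /= /point /= nth_index.
subst K; exists L; move: uK sK; rewrite map_inj_uniq // size_map => uK sK; split=> //.
move=> X Y XL YL XY; rewrite realize_edge; apply: Kb; by rewrite ?map_f ?inj_eq.
Qed.
End Realize.

Lemma iso_homogeneous (V W : finType) (G : sgraph V) (H : sgraph W) b q :
  iso G H -> homogeneous G b q -> homogeneous H b q.
Proof.
case=> f /bij_inj f_inj fE [K [uK sK Kb]]; exists (map f K).
rewrite map_inj_uniq // size_map; split=> // _ _ /mapP[x xK ->] /mapP[y yK ->].
by rewrite inj_eq // fE; apply: Kb.
Qed.

(** [realizable] fixes the lengths up to order only, but the type [packing3 (cycles ns)] depends on
    the list itself. *)
Lemma reorder_lens p ns : perm_eq (lens p) ns -> exists2 p', perm_eq p p' & lens p' = ns.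
Proof.
rewrite perm_sym => /(perm_iotaP 0)[Is Is_perm ns_eq].
pose t0 : cycle3 := ([::], [::], [::]).
rewrite size_map in Is_perm; exists [seq nth t0 p i | i <- Is].
  by rewrite perm_sym; apply/(perm_iotaP t0); exists Is.
rewrite ns_eq /lens -map_comp; apply/eq_in_map => i.
by rewrite (perm_mem Is_perm) mem_iota => lt_i; rewrite /= (nth_map t0).
Qed.

Lemma realizableP ns b q h : realizable ns b q h ->
  exists a : packing3 (cycles ns), homogeneous (packing_sum a) b q <-> h.
Proof.
case=> V [p [Vp pn hom]]; have [p' pp' p'n] := reorder_lens pn.
subst ns; have Vp' : packs V p' by rewrite -(packs_perm _ pp').
exists (realize Vp'); rewrite realize_homogeneous -hom.
split=> -[K [uK sK KV Kb]]; exists K; split=> // x y xK yK xy.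
  by rewrite (links_perm pp') Kb.
by rewrite -(links_perm pp') Kb.
Qed.

Lemma sumn_le8_listed ns : 0 < size ns -> all (leq 3) ns -> sumn ns <= 8 ->
  has (perm_eq ns) (no_packing_list ++ unique_packing_list).
Proof.
case: ns => [|a [|b [|c ns]]] //= _ ns3 sum8.
- by case: a ns3 sum8 => [|[|[|[|[|[|[|[|[|a]]]]]]]]].
(* Two lengths of at least 3 and sum at most 8 lie in 3, 4, 5. *)
- have: (a \in iota 3 3) && (b \in iota 3 3) by rewrite !mem_iota; lia.
  rewrite !inE => /andP[/or3P a_eq /or3P b_eq].
  by case: a_eq b_eq ns3 sum8 => /eqP-> [] /eqP->.
by lia.
Qed.

Theorem theorem10 (ns : seq nat)
    (ns_nonempty : 1 <= size ns) (ns_ge3 : forall m, m \in ns -> 3 <= m) :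
  [/\ one_of (cycles ns) no_packing_list -> ~ has_packing (cycles ns),
      one_of (cycles ns) unique_packing_list -> unique_packing (cycles ns)
    & ~ one_of (cycles ns) no_packing_list ->
      ~ one_of (cycles ns) unique_packing_list ->
      exists a b : packing3 (cycles ns), distinct_packings a b].
Proof.
have ns3 : all (leq 3) ns by apply/allP.
split.
- case=> ms ms_in /iso_card; rewrite !card_cycles => sum_eq [a].
  have := order_gt6 ns3 a ns_nonempty; rewrite sum_eq.
  by move: ms_in; rewrite !inE; do 4?[case/orP => [/eqP-> // |]]; move/eqP->.
- case=> ms ms_in ns_ms; have sum_eq := iso_card ns_ms; rewrite !card_cycles in sum_eq.
  have sum7 : 7 <= sumn ns.
    rewrite sum_eq; move: ms_in; rewrite !inE.
    by do 5?[case/orP => [/eqP-> // |]]; move/eqP->.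
  split.
    by have [h /realizableP[a _]] := packable_ge7 ns3 sum7; exists.
  case=> a [b []]; have [n8 | n9] := leqP (sumn ns) 8.
    by apply: packing_sum_iso => //; apply: nonadj_equivalence_small.
  (* The only listed graph with more than eight vertices. *)
  have ms333 : ms = [:: 3; 3; 3].
    move: ms_in n9; rewrite sum_eq !inE.
    by do 5?[case/orP => [/eqP-> // |]]; move/eqP->.
  have tri : union_of_triangles (cycles ns).
    by apply: iso_triangles ns_ms _; rewrite ms333; apply: cycles_triangles.
  have n_eq : sumn ns = 9 by rewrite sum_eq ms333.
  by apply: packing_sum_iso => //; apply: nonadj_equivalence_triangles.
move=> no_list uniq_list.
have not_in ms : ms \in no_packing_list ++ unique_packing_list -> ~~ perm_eq ns ms.
  rewrite mem_cat => /orP ms_in; apply/negP => /(cycles_iso_perm ns3) ns_ms.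
  by case: ms_in => ms_in; [apply: no_list | apply: uniq_list]; exists ms.
have sum9 : 9 <= sumn ns.
  rewrite ltnNge; apply/negP => /(sumn_le8_listed ns_nonempty ns3)/hasP[ms /not_in].
  by move/negP.
have [b [q [/realizableP[a1 h1] /realizableP[a2 h2]]]] :=
  two_realizations ns3 sum9 (not_in [:: 3; 3; 3] isT).
(* An isomorphism would carry the homogeneous set of the first sum into the second, which has
   none. *)
exists a1, a2 => /(iso_homogeneous (b := b) (q := q)) h12.
by have /h2 := h12 (h1.2 isT).
Qed.
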